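(* Let $n$ be an integer greater than or equal to $2$. Then there exists an injective non-quasinormal weighted shift $S_\lambda\in \boldsymbol{B}(\ell^2(V_{\infty}))$ on the directed tree $\mathcal{T}_{\infty}=(V_\infty,E_\infty)$ such that $$(S_\lambda^{*} S_\lambda)^n=S_\lambda^{*n}S_\lambda^{n}\quad\text{and}\quad (S_\lambda^{*} S_\lambda)^k \neq S_\lambda^{*k}S_\lambda^{k}\ \text{ for all } k\in\{2,3,\ldots\}\setminus\{n\}.$$ Moreover, there exists an injective non-quasinormal composition operator $C$ in an $L^2$-space over a $\sigma$-finite measure space such that $$(C^{*} C)^n=C^{*n}C^{n}\quad\text{and}\quad (C^{*} C)^k \neq C^{*k}C^{k}\ \text{ for all } k\in\{2,3,\ldots\}\setminus\{n\}.$$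
   Context: Here $\mathbb{Z}_+=\{0,1,2,\ldots\}$ and $\mathbb{N}=\{1,2,3,\ldots\}$. For a complex Hilbert space $\mathcal{H}$, $\boldsymbol{B}(\mathcal{H})$ is the set of all bounded operators in $\mathcal{H}$ with domain equal to $\mathcal{H}$. The directed tree $\mathcal{T}_\infty=(V_\infty,E_\infty)$ (rootless, with one branching vertex $0$) has vertex set $V_{\infty}=\{-k:k\in\mathbb{Z}_{+}\}\sqcup\{(i,j):i,j\in\mathbb{N}\}$ and edge set $$E_{\infty}=\{(-k,-k+1):k\in\mathbb{N}\}\sqcup\{(0,(i,1)):i\in\mathbb{N}\}\sqcup\{((i,j),(i,j+1)):i,j\in\mathbb{N}\},$$ where $\sqcup$ denotes disjoint union. For every $v\in V_\infty$, $\mathrm{par}(v)$ denotes the unique vertex $u$ such that $(u,v)\in E_\infty$. $\ell^2(V_\infty)$ is the Hilbert space of square summable complex functions on $V_\infty$ with the standard inner product. Given a system $\lambda=\{\lambda_v\}_{v\in V_\infty}$ of complex numbers, the weighted shift $S_\lambda$ on $\mathcal{T}_\infty$ with weights $\lambda$ is the operator in $\ell^2(V_\infty)$ with domain $\{f\in\ell^2(V_\infty):\Lambda f\in\ell^2(V_\infty)\}$ given by $S_\lambda f=\Lambda f$, where $(\Lambda f)(v)=\lambda_v f(\mathrm{par}(v))$ for $v\in V_\infty$. A composition operator in $L^2(\mu)$, where $(X,\mathcal{A},\mu)$ is a $\sigma$-finite measure space, is an operator of the form $Cf=f\circ\phi$ with domain $\{f\in L^2(\mu): f\circ\phi\in L^2(\mu)\}$,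 where $\phi:X\to X$ is an $\mathcal{A}$-measurable transformation that is nonsingular (i.e. $\mu(\phi^{-1}(\Delta))=0$ whenever $\Delta\in\mathcal{A}$ and $\mu(\Delta)=0$). A closed densely defined operator $A$ in a complex Hilbert space is called quasinormal if $A$ commutes with the spectral measure $E$ of $|A|=(A^*A)^{1/2}$, i.e. $E(\sigma)A\subset AE(\sigma)$ for all Borel subsets $\sigma$ of $[0,\infty)$. *)

(* Defs.v *)
From HB Require Import structures.
From mathcomp Require Import all_boot all_order all_algebra.
From mathcomp Require Import complex.
From mathcomp Require Import all_classical all_reals all_analysis.
From mathcomp Require Import measurable_realfun ring.

Set Implicit Arguments.
Unset Strict Implicit.
Unset Printing Implicit Defensive.

Import Order.TTheory GRing.Theory Num.Theory.
Import numFieldNormedType.Exports.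

Local Open Scope classical_set_scope.
Local Open Scope complex_scope.
Local Open Scope quotient_scope.
Local Open Scope ring_scope.

Section square_integrable.
Context {d : measure_display} {T : measurableType d} {R : realType}.
Variable mu : {measure set T -> \bar R}.
Implicit Types f g : T -> R[i].

Definition cmeasurable f :=
  measurable_fun [set: T] (fun x => complex.Re (f x)) /\
  measurable_fun [set: T] (fun x => complex.Im (f x)).

(* |z|^2 is written out because the norm of R[i] takes its values in R[i]. *)
Definition square_integrable f :=
  cmeasurable f /\
  (\int[mu]_x (complex.Re (f x) ^+ 2 + complex.Im (f x) ^+ 2)%:E < +oo)%E.

Lemma Lfun2P (f : T -> R) : f \in Lfun mu 2%:E <->
  measurable_fun [set: T] f /\ (\int[mu]_x (f x ^+ 2)%:E < +oo)%E.
Proof.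
split=> [f2|[mf fi]].
  split; first by move: f2; rewrite inE => /andP[]; rewrite inE.
  have /integrableP[_] := Lfun2_integrable_sqr f2.
  apply: le_lt_trans; rewrite le_eqVlt; apply/orP; left; apply/eqP.
  by apply: eq_integral => x _ /=; rewrite ger0_norm// sqr_ge0.
rewrite inE; apply/andP; split; rewrite inE//=.
rewrite /finite_norm unlock; apply: poweR_lty.
apply: le_lt_trans fi; rewrite le_eqVlt; apply/orP; left; apply/eqP.
apply: eq_integral => x _ /=.
by rewrite powR_mulrn// real_normK ?num_real.
Qed.

Lemma square_integrableP f : square_integrable f <->
  (fun x => complex.Re (f x)) \in Lfun mu 2%:E /\
  (fun x => complex.Im (f x)) \in Lfun mu 2%:E.
Proof.
have m2 (h : T -> R) : measurable_fun [set: T] h ->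
    measurable_fun [set: T] (fun x => (h x ^+ 2)%:E).
  by move=> mh; apply/measurable_EFinP; exact: measurable_funX.
have sq0 (h : T -> R) x : (0 <= (h x ^+ 2)%:E)%E by rewrite lee_fin sqr_ge0.
split=> [[[mr mi] fi]|[/Lfun2P[mr ir] /Lfun2P[mi ii]]].
  split; apply/Lfun2P; split=> //; apply: le_lt_trans fi;
    apply: ge0_le_integral => //=; try exact: m2.
  - by move=> x _; rewrite lee_fin sqr_ge0.
  - by apply/measurable_EFinP; apply: measurable_funD; exact: measurable_funX.
  - by move=> x _; rewrite lee_fin lerDl sqr_ge0.
  - by move=> x _; rewrite lee_fin sqr_ge0.
  - by apply/measurable_EFinP; apply: measurable_funD; exact: measurable_funX.
  - by move=> x _; rewrite lee_fin lerDr sqr_ge0.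
split=> //; under eq_integral do rewrite EFinD.
rewrite ge0_integralD//; first exact: lte_add_pinfty.
- by move=> x _; rewrite lee_fin sqr_ge0.
- exact: m2.
- by move=> x _; rewrite lee_fin sqr_ge0.
- exact: m2.
Qed.

End square_integrable.

Section L2.
Context {d : measure_display} {T : measurableType d} {R : realType}.
Variable mu : {measure set T -> \bar R}.

Definition sqint_pred : {pred (T -> R[i])} := fun f => `[< square_integrable mu f >].

Lemma sqint_submod : submod_closed sqint_pred.
Proof.
have one2 : (1 <= 2%:E :> \bar R)%E by rewrite lee_fin ler1n.
have [L0 LZD] := Lfun_submod_closed mu one2.
split=> [|a f g]; rewrite !unfold_in.
  by apply/asboolP/square_integrableP; split; exact: L0.
move=> /asboolP/square_integrableP[fr fi] /asboolP/square_integrableP[gr gi].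
have lD (h k : T -> R) : h \in Lfun mu 2%:E -> k \in Lfun mu 2%:E ->
    (fun x => h x + k x) \in Lfun mu 2%:E.
  by move=> h2 k2; have := LZD 1 h k h2 k2; rewrite scale1r.
have lZ (b : R) (h : T -> R) :
    h \in Lfun mu 2%:E -> (fun x => b * h x) \in Lfun mu 2%:E.
  by move=> h2; have := LZD b h _ h2 L0; rewrite addr0.
have reE x : complex.Re ((a *: f + g) x) = (complex.Re a * complex.Re (f x) +
    - complex.Im a * complex.Im (f x)) + complex.Re (g x).
  rewrite [(a *: f + g) x]/(a * f x + g x).
  by case: (a) (f x) (g x) => [? ?] [? ?] [? ?]/=; rewrite mulNr.
have imE x : complex.Im ((a *: f + g) x) = (complex.Re a * complex.Im (f x) +
    complex.Im a * complex.Re (f x)) + complex.Im (g x).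
  rewrite [(a *: f + g) x]/(a * f x + g x).
  by case: (a) (f x) (g x) => [? ?] [? ?] [? ?].
apply/asboolP/square_integrableP; split.
  rewrite (funext reE).
  exact: lD (lD _ _ (lZ _ _ fr) (lZ _ _ fi)) gr.
rewrite (funext imE).
exact: lD (lD _ _ (lZ _ _ fi) (lZ _ _ fr)) gi.
Qed.

HB.instance Definition _ :=
  GRing.isSubmodClosed.Build R[i] (T -> R[i]) sqint_pred sqint_submod.

Record L2fun := MkL2fun { L2val :> T -> R[i]; _ : L2val \in sqint_pred }.

HB.instance Definition _ := [isSub for L2val].
HB.instance Definition _ := [Choice of L2fun by <:].
HB.instance Definition _ := [SubChoice_isSubLmodule of L2fun by <:].

Definition ae_null : {pred L2fun} := fun f => `[< f = cst 0 %[ae mu] >].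

Lemma ae_null_submod : submod_closed ae_null.
Proof.
split=> [|a f g]; rewrite !unfold_in.
  by apply/asboolP/nearW.
move=> /asboolP f0 /asboolP g0; apply/asboolP.
apply: filterS2 f0 g0 => x f0 g0 _ /=.
transitivity (a * f x + g x); first by [].
by rewrite f0// g0// /cst mulr0 addr0.
Qed.

HB.instance Definition _ :=
  GRing.isSubmodClosed.Build R[i] L2fun ae_null ae_null_submod.

Definition L2 : Type := @Quotient.quot L2fun ae_null.
HB.instance Definition _ := GRing.Zmodule.on L2.
HB.instance Definition _ := EqQuotient.on L2.

Lemma L2_eqP (f g : L2fun) : \pi_L2 f = \pi_L2 g <-> f = g %[ae mu].
Proof.
have -> : (\pi_L2 f = \pi_L2 g) <-> f - g \in ae_null.
  by rewrite (Quotient.idealrBE ae_null); split=> /eqP.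
rewrite unfold_in; split=> [/asboolP|] h.
  apply: filterS h => x fg0 _; apply/eqP; rewrite -subr_eq0; apply/eqP.
  exact: fg0.
apply/asboolP; apply: filterS h => x fg _.
by transitivity (f x - g x); [by []|rewrite fg// subrr].
Qed.

Definition L2_fun (f : L2) : T -> R[i] := repr f.

Lemma repr_pi (f : L2fun) : repr (\pi_L2 f) = f %[ae mu].
Proof. by apply/L2_eqP; rewrite reprK. Qed.

Definition L2_scale (a : R[i]) (f : L2) : L2 := \pi_L2 (a *: repr f).

Lemma pi_scale a (f : L2fun) : L2_scale a (\pi_L2 f) = \pi_L2 (a *: f).
Proof.
apply/L2_eqP; apply: filterS (repr_pi f) => x fE _.
by transitivity (a * (repr (\pi_L2 f) : L2fun) x); [by []|rewrite fE].
Qed.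

Lemma L2W (P : L2 -> Prop) : (forall f, P (\pi_L2 f)) -> forall f, P f.
Proof. by move=> Ppi f; rewrite -[f]reprK; exact: Ppi. Qed.

Lemma L2_scaleA a b f : L2_scale a (L2_scale b f) = L2_scale (a * b) f.
Proof. by elim/L2W: f => f; rewrite !pi_scale scalerA. Qed.

Lemma L2_scale1 : left_id 1 L2_scale.
Proof. by elim/L2W => f; rewrite pi_scale scale1r. Qed.

Lemma L2_scaleDr : right_distributive L2_scale +%R.
Proof.
move=> a; elim/L2W => f; elim/L2W => g.
by rewrite -raddfD !pi_scale scalerDr raddfD.
Qed.

Lemma L2_scaleDl f : {morph L2_scale^~ f : a b / a + b}.
Proof. by move=> a b; elim/L2W: f => f; rewrite !pi_scale scalerDl raddfD. Qed.

HB.instance Definition _ := GRing.Zmodule_isLmodule.Build R[i] L2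
  L2_scaleA L2_scale1 L2_scaleDr L2_scaleDl.

Definition cintegral (h : T -> R[i]) : R[i] :=
  (\int[mu]_x complex.Re (h x)) +i* (\int[mu]_x complex.Im (h x)).

Definition L2dot (f g : L2) : R[i] :=
  cintegral (fun x => L2_fun f x * (L2_fun g x)^*).

Lemma L2_fun_lin a (f g : L2) :
  L2_fun (a *: f + g) = (fun x => a * L2_fun f x + L2_fun g x) %[ae mu].
Proof.
have -> : a *: f + g = \pi_L2 (a *: (repr f : L2fun) + repr g).
  transitivity (\pi_L2 (a *: (repr f : L2fun)) + \pi_L2 (repr g)).
    by rewrite -pi_scale !reprK.
  by rewrite raddfD.
exact: repr_pi.
Qed.

Lemma L2_fun_sqint (f : L2) : square_integrable mu (L2_fun f).
Proof.
by rewrite /L2_fun; case: (repr f : L2fun) => h /= hP; apply/asboolP.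
Qed.

Let ReM (f g : L2) x : complex.Re (L2_fun f x * (L2_fun g x)^*) =
  1 * (complex.Re (L2_fun f x) * complex.Re (L2_fun g x)) +
  complex.Im (L2_fun f x) * complex.Im (L2_fun g x).
Proof.
by case: (L2_fun f x) (L2_fun g x) => [? ?] [? ?]/=; rewrite mul1r mulrN opprK.
Qed.

Let ImM (f g : L2) x : complex.Im (L2_fun f x * (L2_fun g x)^*) =
  - 1 * (complex.Re (L2_fun f x) * complex.Im (L2_fun g x)) +
  complex.Im (L2_fun f x) * complex.Re (L2_fun g x).
Proof.
by case: (L2_fun f x) (L2_fun g x) => [? ?] [? ?]/=; rewrite mulrN mulN1r.
Qed.

Lemma integrable_ReM (f g : L2) : mu.-integrable setT
  (EFin \o fun x => complex.Re (L2_fun f x * (L2_fun g x)^*)).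
Proof.
have /square_integrableP[fr fi] := L2_fun_sqint f.
have /square_integrableP[gr gi] := L2_fun_sqint g.
rewrite (funext (ReM f g)); apply/Lfun1_integrable.
have [_ LZD] := Lfun_submod_closed mu (lexx 1%E).
exact: LZD _ _ _ (Lfun2_mul_Lfun1 fr gr) (Lfun2_mul_Lfun1 fi gi).
Qed.

Lemma integrable_ImM (f g : L2) : mu.-integrable setT
  (EFin \o fun x => complex.Im (L2_fun f x * (L2_fun g x)^*)).
Proof.
have /square_integrableP[fr fi] := L2_fun_sqint f.
have /square_integrableP[gr gi] := L2_fun_sqint g.
rewrite (funext (ImM f g)); apply/Lfun1_integrable.
have [_ LZD] := Lfun_submod_closed mu (lexx 1%E).
exact: LZD _ _ _ (Lfun2_mul_Lfun1 fr gi) (Lfun2_mul_Lfun1 fi gr).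
Qed.

Lemma ae_eq_Rintegral (h k : T -> R) :
  mu.-integrable setT (EFin \o h) -> mu.-integrable setT (EFin \o k) ->
  h = k %[ae mu] -> \int[mu]_x h x = \int[mu]_x k x.
Proof.
move=> /integrableP[mh _] /integrableP[mk _] hk; congr fine.
apply: ae_eq_integral => //; apply: filterS hk => x hk _ /=.
by rewrite hk.
Qed.

Lemma integrable_lin3 (a b : R) (p q r : T -> R) :
  mu.-integrable setT (EFin \o p) -> mu.-integrable setT (EFin \o q) ->
  mu.-integrable setT (EFin \o r) ->
  mu.-integrable setT (EFin \o fun x => a * p x + (b * q x + r x)) /\
  \int[mu]_x (a * p x + (b * q x + r x)) =
  a * \int[mu]_x p x + (b * \int[mu]_x q x + \int[mu]_x r x).
Proof.
move=> ip iq ir.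
have [L0 LZD] := Lfun_submod_closed mu (lexx 1%E).
have L1 (h : T -> R) := (@Lfun1_integrable _ _ _ mu h).
have iqr : mu.-integrable setT (EFin \o fun x => b * q x + r x).
  by apply/L1; apply: (LZD b q r); apply/L1.
have iZ (c : R) (h : T -> R) : mu.-integrable setT (EFin \o h) ->
    mu.-integrable setT (EFin \o fun x => c * h x).
  by move=> ih; apply/L1; have := LZD c h 0; rewrite addr0; apply; [exact/L1|].
split; first by apply/L1; apply: (LZD a p); apply/L1.
by rewrite RintegralD ?RintegralZl ?RintegralD ?RintegralZl//; exact: iZ.
Qed.

Lemma L2dot_linear (g : L2) : linear_for *%R (L2dot ^~ g).
Proof.
move=> a f f'.
have fE := L2_fun_lin a f f'.
rewrite /L2dot /cintegral.
have [ire reE] := integrable_lin3 (complex.Re a) (- complex.Im a)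
  (integrable_ReM f g) (integrable_ImM f g) (integrable_ReM f' g).
have [iim imE] := integrable_lin3 (complex.Re a) (complex.Im a)
  (integrable_ImM f g) (integrable_ReM f g) (integrable_ImM f' g).
rewrite (ae_eq_Rintegral (integrable_ReM _ _) ire); last first.
  apply: filterS fE => x -> // _.
  case: (a) (L2_fun f x) (L2_fun f' x) (L2_fun g x) => [? ?] [? ?] [? ?] [? ?] /=.
  by ring.
rewrite (ae_eq_Rintegral (integrable_ImM _ _) iim); last first.
  apply: filterS fE => x -> // _.
  case: (a) (L2_fun f x) (L2_fun f' x) (L2_fun g x) => [? ?] [? ?] [? ?] [? ?] /=.
  by ring.
rewrite reE imE; case: (a) => [? ?] /=.
by apply/eqP; rewrite eq_complex /=; apply/andP; split; apply/eqP; ring.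
Qed.

Lemma L2dot_herm (f g : L2) :
  L2dot f g = (-1) ^+ false * Num.conj_op (L2dot g f).
Proof.
rewrite expr0 mul1r [RHS]/(conjc (L2dot g f)) /L2dot /cintegral /=.
congr (_ +i* _).
  apply: eq_Rintegral => x _.
  by case: (L2_fun f x) (L2_fun g x) => [? ?] [? ?] /=; ring.
rewrite -mulN1r -RintegralZl//; last exact: integrable_ImM.
apply: eq_Rintegral => x _.
by case: (L2_fun f x) (L2_fun g x) => [? ?] [? ?] /=; ring.
Qed.

Lemma L2dot_linearr (f : L2) : linear_for (Num.conj_op \; *%R) (L2dot f).
Proof.
move=> a g g'; rewrite (L2dot_herm f) L2dot_linear.
by rewrite expr0 mul1r rmorphD rmorphM/= (L2dot_herm f g) (L2dot_herm f g')
  !expr0 !mul1r.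
Qed.

Lemma L2dot_gt0 (f : L2) : f != 0 -> 0 < L2dot f f.
Proof.
move=> f0; rewrite ltcE /L2dot /cintegral /=.
have im0 x : complex.Im (L2_fun f x * (L2_fun f x)^*) = 0.
  by case: (L2_fun f x) => [? ?] /=; ring.
have re0 x : 0 <= complex.Re (L2_fun f x * (L2_fun f x)^*).
  by rewrite ReM mul1r addr_ge0// -expr2 sqr_ge0.
under eq_Rintegral do rewrite im0.
rewrite /Rintegral integral0 /= eqxx /=.
have := integrable_ReM f f.
set h := fun x => _.
move=> ih.
rewrite lt_neqAle Rintegral_ge0// andbT.
apply: contra_neq f0 => int0.
have : (\int[mu]_x `|(h x)%:E| = 0)%E.
  rewrite -[RHS]/(0%:E) int0 /Rintegral fineK; last exact: integrable_fin_num ih.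
  by apply: eq_integral => x _; rewrite /= (ger0_norm (re0 x)).
move/(ae_eq_integral_abs mu measurableT (measurable_int _ ih)) => h0.
rewrite -[f]reprK -[0]reprK; apply/L2_eqP.
have zE : (repr (0 : L2) : L2fun) = (0 : L2fun) %[ae mu].
  by rewrite -[0 : L2](raddf0 \pi_L2); exact: repr_pi.
apply: filterS2 h0 zE => x hx -> // _; apply/eqP; rewrite -[_ == _]/(L2_fun f x == 0).
have /eqP := hx Logic.I; rewrite eqe /h ReM mul1r -!expr2.
rewrite paddr_eq0 ?sqr_ge0// !sqrf_eq0 => /andP[/eqP r0 /eqP i0].
by rewrite eq_complex r0 i0/= eqxx.
Qed.

HB.instance Definition _ := bilinear_isBilinear.Build R[i] L2 L2 R[i]
  (GRing.Scale.Law.clone _ _ *%R _)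
  (GRing.Scale.Law.clone _ _ (Num.conj_op \; *%R) _)
  L2dot (L2dot_linear, L2dot_linearr).
HB.instance Definition _ :=
  isHermitianSesquilinear.Build R[i] L2 false Num.conj_op L2dot L2dot_herm.
HB.instance Definition _ := isDotProduct.Build R[i] L2 L2dot L2dot_gt0.

End L2.

(* Possibly unbounded operators in H are identified with their graphs, so that
   = and `<=` are the usual equality and extension of operators. *)
Definition oper {R : realType} (H : lmodType R[i]) := set (H * H).

Arguments L2dot {d T R mu}.

(* The definitions below are applied to the spaces L2 mu only; the completeness
   of these is the Riesz-Fischer theorem and is not needed to state them. *)
Section operators.
Context {R : realType} {H : lmodType R[i]}.
Variable ip : {dot H for @Num.conj_op R[i]}.
Implicit Types (A B : oper H) (f : H -> H) (x y z w : H).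

Definition is_operator A :=
  A (0, 0) /\
  (forall (a : R[i]) x y z w, A (x, y) -> A (z, w) ->
     A (a *: x + z, a *: y + w)) /\
  (forall x y z, A (x, y) -> A (x, z) -> y = z).

Definition odom A : set H := [set x | exists y, A (x, y)].

Definition ograph f : oper H := [set p | p.2 = f p.1].

(* A after B, with the natural domain *)
Definition ocomp A B : oper H :=
  [set p | exists2 y, B (p.1, y) & A (y, p.2)].

Definition opow A (n : nat) : oper H := iter n (ocomp A) (ograph id).

(* (y, z) belongs to A^* iff <Ax, y> = <x, z> for all x in the domain of A;
   this is the graph of a function when A is densely defined. *)
Definition adjoint A : oper H :=
  [set p | forall x y, A (x, y) -> ip y p.1 = ip x p.2].

Definition oinjective A := forall x z y, A (x, y) -> A (z, y) -> x = z.

Definition hnorm x : R := Num.sqrt (complex.Re (ip x x)).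

(* membership in B(H) *)
Definition bounded_everywhere A :=
  [/\ is_operator A, odom A = setT &
      exists M : R, forall x y, A (x, y) -> hnorm y <= M * hnorm x].

Definition densely_defined A :=
  forall x (e : R), 0 < e -> exists2 z, odom A z & hnorm (z - x) < e.

Definition closed_operator A :=
  forall (u v : nat -> H) x y, (forall n, A (u n, v n)) ->
    hnorm (u n - x) @[n --> \oo] --> (0 : R) ->
    hnorm (v n - y) @[n --> \oo] --> (0 : R) -> A (x, y).

Definition closed_densely_defined A :=
  [/\ is_operator A, closed_operator A & densely_defined A].

Definition positive_selfadjoint A :=
  [/\ is_operator A, densely_defined A, adjoint A = A &
      forall x y, A (x, y) -> 0 <= ip y x].

(* T = |A| = (A^* A)^(1/2) *)
Definition is_modulus A T :=
  positive_selfadjoint T /\ ocomp T T = ocomp (adjoint A) A.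

(* A spectral measure on the Borel subsets of [0, +oo[, seen as one on the Borel
   subsets of R carried by [0, +oo[. Countable additivity is the existence of
   the scalar measures sm_scalar x = <E(.)x, x>; the values of sm_proj on
   non-Borel sets are irrelevant. *)
Record spectral_measure := SpectralMeasure {
  sm_proj :> set R -> H -> H ;
  sm_scalar : H -> {measure set R -> \bar R} ;
  sm_linear : forall s, measurable s -> linear (sm_proj s) ;
  sm_selfadjoint : forall s x y, measurable s ->
    ip (sm_proj s x) y = ip x (sm_proj s y) ;
  sm_idempotent : forall s x, measurable s ->
    sm_proj s (sm_proj s x) = sm_proj s x ;
  sm_total : forall x, sm_proj `[0, +oo[ x = x ;
  sm_scalarE : forall s x, measurable s ->
    sm_scalar x s = (complex.Re (ip (sm_proj s x) x))%:E }.

(* T = \int t dE(t); the operator is determined by its domain and its quadratic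
   form, by polarization. *)
Definition is_spectral_measure_of T (E : spectral_measure) :=
  (forall x, odom T x <->
     (\int[sm_scalar E x]_(t in `[0%R, +oo[) (t ^+ 2)%:E < +oo)%E) /\
  (forall x y, T (x, y) ->
     ip y x = (\int[sm_scalar E x]_(t in `[0, +oo[) t)%:C).

Definition quasinormal A :=
  closed_densely_defined A /\
  exists T (E : spectral_measure),
    [/\ is_modulus A T, is_spectral_measure_of T E &
        forall s : set R, measurable s -> s `<=` `[0, +oo[ ->
          ocomp (ograph (E s)) A `<=` ocomp A (ograph (E s))].

End operators.

Section composition_operator.
Context {d : measure_display} {X : measurableType d} {R : realType}.
Variable mu : {measure set X -> \bar R}.

Definition nonsingular (phi : X -> X) :=
  forall D, measurable D -> mu D = 0%E -> mu (phi @^-1` D) = 0%E.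

Definition composition_operator (phi : X -> X) : oper (L2 mu) :=
  [set p | L2_fun p.2 = L2_fun p.1 \o phi %[ae mu]].

End composition_operator.
Arguments composition_operator {d X R} mu phi.

(* Trunk k is the vertex -k; Branch i j is the vertex (i+1, j+1). *)
Inductive Vinf := Trunk of nat | Branch of nat & nat.

Definition Vinf_code (v : Vinf) : nat + nat * nat :=
  match v with Trunk k => inl k | Branch i j => inr (i, j) end.
Definition Vinf_decode (c : nat + nat * nat) : Vinf :=
  match c with inl k => Trunk k | inr (i, j) => Branch i j end.
Lemma Vinf_codeK : cancel Vinf_code Vinf_decode. Proof. by case. Qed.

HB.instance Definition _ := Countable.copy Vinf (can_type Vinf_codeK).
HB.instance Definition _ := isPointed.Build Vinf (Trunk 0).
HB.instance Definition _ := @isMeasurable.Build default_measure_display Vinf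
  discrete_measurable discrete_measurable0
  discrete_measurableC discrete_measurableU.

Inductive Einf : Vinf -> Vinf -> Prop :=
| Etrunk k : Einf (Trunk k.+1) (Trunk k)
| Eroot i : Einf (Trunk 0) (Branch i 0)
| Ebranch i j : Einf (Branch i j) (Branch i j.+1).

Definition par (v : Vinf) : Vinf :=
  match v with
  | Trunk k => Trunk k.+1
  | Branch _ 0 => Trunk 0
  | Branch i j.+1 => Branch i j
  end.

Lemma parP u v : Einf u v <-> u = par v.
Proof.
by split=> [[]//|->]; case: v => [k|i [|j]]; constructor.
Qed.

Section weighted_shift.
Variable R : realType.

Definition ell2Vinf := L2 (@counting Vinf R : {measure set Vinf -> \bar R}).

Definition weighted_shift (lam : Vinf -> R[i]) : oper ell2Vinf :=
  [set p | forall v, L2_fun p.2 v = lam v * L2_fun p.1 (par v)].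

End weighted_shift.

(* Main.v *)
(* On a discrete measure space over Vinf let A f = w . (f o par), with
   m(v) w(v)^2 = m(par v) a(v), where m(v) is the mass of v.  Weighted shifts
   (m = 1, w = sqrt a) and composition operators (w = 1) are both of this form.
   By the change of variables along par, A^* rho A is multiplication by
   (T rho)(u) = sum of a(v) rho(v) over the children v of u, so A^{*k} A^k is
   multiplication by T^k 1 and (A^* A)^k by (T 1)^k; one needs weights a for
   which these agree for k = n and for no other k >= 2.
   Two branches at 0 carry weights p_i on the first edge and t_i on all further
   ones, where the law P(t = t_i) = p_i has mean E[t^{n-1}] = 1 but
   E[t^j] <> 1 for j <> 0, n - 1.  This settles the vertex 0, and the weights on
   the trunk are then forced one after the other by (n-1)-st roots.
   A spectral measure of |A| commuting with A would send e_0 to itself and e_v to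
   0 for some spectral interval [0, c] and the child v of 0 with (T 1)(v) = 2 >
   1 = (T 1)(0), contradicting <A e_0, e_v> <> 0. *)
From HB Require Import structures.
Require Import Defs.
From mathcomp Require Import all_boot all_order all_algebra.
From mathcomp Require Import complex.
From mathcomp Require Import all_classical all_reals all_analysis.
From mathcomp Require Import ring lra measurable_realfun.

Set Implicit Arguments.
Unset Strict Implicit.
Unset Printing Implicit Defensive.

Import Order.TTheory GRing.Theory Num.Theory.
Import numFieldNormedType.Exports.

Local Open Scope classical_set_scope.
Local Open Scope ring_scope.

(** * Spectral projections *)

Section real_inner_product.
Context {R : realType} {H : lmodType R[i]}.
Variable ip : {dot H for @Num.conj_op R[i]}.
Implicit Types (x y z : H) (a : R).

Definition rip x y : R := complex.Re (ip x y).

Lemma ripDl x y z : rip (x + y) z = rip x z + rip y z.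
Proof. by rewrite /rip linearDl raddfD. Qed.

Lemma ripC x y : rip x y = rip y x.
Proof.
rewrite /rip hermC expr0 mul1r.
by rewrite -[LHS]/(complex.Re (conjc (ip y x))); case: (ip y x).
Qed.

Lemma ripDr x y z : rip x (y + z) = rip x y + rip x z.
Proof. by rewrite ripC ripDl !(ripC x). Qed.

Lemma ripZl a x y : rip (a%:C%C *: x) y = a * rip x y.
Proof. by rewrite /rip linearZl_LR /=; case: (ip x y) => u v /=; ring. Qed.

Lemma ripZr a x y : rip x (a%:C%C *: y) = a * rip x y.
Proof. by rewrite ripC ripZl ripC. Qed.

Lemma ripNl x y : rip (- x) y = - rip x y.
Proof. by rewrite /rip linearNl raddfN. Qed.

Lemma ripNr x y : rip x (- y) = - rip x y.
Proof. by rewrite ripC ripNl ripC. Qed.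

Lemma rip_eq0 x : (rip x x == 0) = (x == 0).
Proof.
apply/idP/eqP => [|->]; last by rewrite /rip linear0l.
by apply: contraTeq; rewrite -(dnorm_gt0 ip) ltcE => /andP[_ /lt0r_neq0].
Qed.

Lemma rip_ge0 x : 0 <= rip x x.
Proof.
have [->|] := eqVneq x 0; first by rewrite /rip linear0l.
by rewrite -(dnorm_gt0 ip) ltcE => /andP[_ /ltW].
Qed.


Lemma rip_sqD x y : rip (x + y) (x + y) = rip x x + rip y y + rip x y *+ 2.
Proof. by rewrite ripDl !ripDr (ripC y x); ring. Qed.

Lemma rip_sqN x : rip (- x) (- x) = rip x x.
Proof. by rewrite ripNl ripNr opprK. Qed.

End real_inner_product.

(** * Additivity and orthogonality of spectral projections *)

Section spectral_projections.
Context {R : realType} {H : lmodType R[i]}.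
Variables (ip : {dot H for @Num.conj_op R[i]}) (E : spectral_measure ip).
Implicit Types (x y z : H) (s t : set R).

Let smD s x y : measurable s -> E s (x + y) = E s x + E s y.
Proof. by move=> ms; rewrite -[in LHS](scale1r x) (sm_linear E ms) scale1r. Qed.

Let smB s x y : measurable s -> E s (x - y) = E s x - E s y.
Proof.
by move=> ms; rewrite addrC -scaleN1r (sm_linear E ms) scaleN1r addrC.
Qed.

Lemma sm_rip s x y : measurable s -> rip ip (E s x) y = rip ip x (E s y).
Proof. by move=> ms; rewrite /rip sm_selfadjoint. Qed.

Lemma sm_rip_proj s x y : measurable s ->
  rip ip (E s x) (E s y) = rip ip (E s x) y.
Proof. by move=> ms; rewrite sm_rip// sm_idempotent// -sm_rip. Qed.

Lemma sm_scalar_rip s x : measurable s ->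
  sm_scalar E x s = (rip ip (E s x) (E s x))%:E.
Proof. by move=> ms; rewrite sm_scalarE// sm_rip_proj. Qed.

Lemma sm_pythagoras s x : measurable s ->
  rip ip x x = rip ip (E s x) (E s x) + rip ip (x - E s x) (x - E s x).
Proof.
by move=> ms; rewrite [in RHS]rip_sqD rip_sqN ripNr (ripC _ x) sm_rip_proj//; ring.
Qed.

Lemma sm_le s x : measurable s -> rip ip (E s x) (E s x) <= rip ip x x.
Proof. by move=> ms; rewrite (sm_pythagoras x ms) lerDl rip_ge0. Qed.

Lemma sm_fix s x : measurable s ->
  rip ip (E s x) (E s x) = rip ip x x -> E s x = x.
Proof.
move=> ms Ex; have := sm_pythagoras x ms; rewrite Ex => /eqP.
rewrite addrC -subr_eq subrr eq_sym rip_eq0 subr_eq0 => /eqP xE.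
exact/esym.
Qed.

(** Monotonicity of the scalar measure turns [sm_total] into a lower bound for the norm of E(R)x,
    and a projection that preserves the norm of x fixes x. *)
Lemma sm_setT x : E setT x = x.
Proof.
apply: sm_fix => //; apply/eqP; rewrite eq_le sm_le//= -lee_fin.
rewrite -[in leLHS](sm_total E x) -!sm_scalar_rip//.
by apply: le_measure; rewrite ?inE.
Qed.

Let sm_scalarU s t x : measurable s -> measurable t -> [disjoint s & t] ->
  rip ip (E (s `|` t) x) (E (s `|` t) x) =
  rip ip (E s x) (E s x) + rip ip (E t x) (E t x).
Proof.
move=> ms mt /disj_set2P st0; have mst := measurableU _ _ ms mt.
apply: EFin_inj; rewrite EFinD -!sm_scalar_rip//.
by rewrite measureU.
Qed.

(** Multiplicativity of E is derived from additivity of the scalar measures. For z = E(t)x,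
    additivity gives |E(s [|] t)z|^2 = |E(s)z|^2 + |z|^2, while a projection does not increase the
    norm, so E(s)z = 0. *)
Lemma sm_disjoint s t x : measurable s -> measurable t -> [disjoint s & t] ->
  E s (E t x) = 0.
Proof.
move=> ms mt st; have mst := measurableU _ _ ms mt.
apply/eqP; rewrite -(rip_eq0 ip) eq_le rip_ge0 andbT.
have := sm_le (E t x) mst.
by rewrite sm_scalarU// sm_idempotent// gerDr.
Qed.

Lemma sm_union s t x : measurable s -> measurable t -> [disjoint s & t] ->
  E (s `|` t) x = E s x + E t x.
Proof.
move=> ms mt st; have mst := measurableU _ _ ms mt.
have ts : [disjoint t & s] by rewrite disj_set_sym.
have z0 : rip ip (0 : H) 0 = 0 by apply/eqP; rewrite rip_eq0.
have Us y : E (s `|` t) (E s y) = E s y.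
  by apply: sm_fix => //; rewrite sm_scalarU// sm_idempotent// sm_disjoint// z0 addr0.
have Ut y : E (s `|` t) (E t y) = E t y.
  by apply: sm_fix => //; rewrite sm_scalarU// sm_idempotent// sm_disjoint// z0 add0r.
(* The projection of the union fixes E(s)x and E(t)x, so it remains to see that it kills the rest of
   x. *)
have : E (s `|` t) (x - E s x - E t x) = 0.
  apply/eqP; rewrite -(rip_eq0 ip) sm_scalarU// !smB// !sm_idempotent//.
  by rewrite !sm_disjoint// !subrr !subr0 subrr z0 addr0.
by rewrite !smB// Us Ut => /eqP; rewrite subr_eq add0r subr_eq addrC => /eqP.
Qed.

Lemma sm_setC s x : measurable s -> x = E s x + E (~` s) x.
Proof.
move=> ms; rewrite -sm_union//; last exact/disj_set2P/setICr.
- by rewrite setUv sm_setT.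
- exact: measurableC.
Qed.

Lemma sm_orthogonal s t s' x : measurable s -> measurable t -> measurable s' ->
  [disjoint s & t] -> rip ip (E s' (E s x)) (E s' (E t x)) = 0.
Proof.
move=> ms mt ms' st; have mI := measurableI _ _ ms' ms.
have mD := measurableD ms' ms.
rewrite sm_rip_proj//.
have -> : E s' (E s x) = E (s' `&` s) (E s x).
  rewrite -[in LHS](setUIDK s' s) sm_union//.
    rewrite (@sm_disjoint (s' `\` s))// ?addr0//.
    by apply/disj_set2P; rewrite setDE -setIA setICl setI0.
  by apply/disj_set2P; rewrite setDE setIACA setICr setI0.
rewrite sm_rip// (@sm_disjoint (s' `&` s) t)//.
  by rewrite /rip linear0r.
apply/disj_set2P; move/disj_set2P: st => st.
by rewrite -setIA st setI0.
Qed.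

Lemma sm_scalarD s x t : measurable s -> measurable t ->
  sm_scalar E x t = (sm_scalar E (E s x) t + sm_scalar E (E (~` s) x) t)%E.
Proof.
move=> ms mt; have mC := measurableC ms.
rewrite !sm_scalar_rip// -EFinD {1 2}(sm_setC x ms) smD// rip_sqD.
rewrite (sm_orthogonal x ms mC mt); last exact/disj_set2P/setICr. 
by rewrite mul0rn addr0.
Qed.

Lemma sm_scalar_total x : sm_scalar E x `[0, +oo[%classic = (rip ip x x)%:E.
Proof. by rewrite sm_scalar_rip// sm_total. Qed.

Lemma sm_scalarC s x : measurable s -> sm_scalar E (E s x) (~` s) = 0%E.
Proof.
move=> ms; have mC := measurableC ms.
rewrite sm_scalar_rip// sm_disjoint//; first by rewrite /rip linear0l.
exact/disj_set2P/setICl.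
Qed.

End spectral_projections.

(** * Quadratic forms as spectral integrals, and eigenvectors *)

Section spectral_integral.
Context {R : realType} {H : lmodType R[i]}.
Variables (ip : {dot H for @Num.conj_op R[i]}) (E : spectral_measure ip).
Implicit Types (x : H) (s : set R).

(** This is the quadratic form <Tx, x> of an operator T with spectral measure E, kept in the
    extended reals so that it can be split and compared before finiteness is known. *)
Definition sm_mean x := (\int[sm_scalar E x]_(t in `[0%R, +oo[) t%:E)%E.

Let sm_ge0 (t : R) : `[0, +oo[%classic t -> (0 <= t%:E)%E.
Proof. by rewrite /= in_itv /= andbT lee_fin. Qed.

Let mid : measurable_fun (`[0, +oo[%classic : set R) (EFin : R -> \bar R).
Proof. exact/measurable_EFinP. Qed.

Lemma sm_mean_fin x :
  (\int[sm_scalar E x]_(t in `[0%R, +oo[) (t ^+ 2)%:E < +oo)%E ->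
  sm_mean x \is a fin_num.
Proof.
move=> x2; rewrite ge0_fin_numE; last exact: integral_ge0.
have m2 : measurable_fun (`[0, +oo[%classic : set R) (fun t : R => (t ^+ 2)%:E).
  by apply/measurable_EFinP; exact: measurable_funX.
(* Domination by t <= t^2 + 1; the constant is integrable since the scalar measure has total mass
   |x|^2. *)
apply: (@le_lt_trans _ _
    (\int[sm_scalar E x]_(t in `[0%R, +oo[) ((t ^+ 2)%:E + cst 1%E t))%E).
  apply: ge0_le_integral => //.
  - by apply: emeasurable_funD.
  - move=> t _; rewrite /= -EFinD lee_fin.
    by have := sqr_ge0 (t - 1); nra.
rewrite ge0_integralD//; last first.
  by move=> t _; rewrite lee_fin sqr_ge0.
rewrite integral_cst// mul1e sm_scalar_total.
by apply: lte_add_pinfty => //; rewrite ltry.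
Qed.

Lemma sm_meanD s x : measurable s ->
  sm_mean x = (sm_mean (E s x) + sm_mean (E (~` s) x))%E.
Proof.
move=> ms; rewrite -ge0_integral_measure_add//.
apply: eq_measure_integral => t mt _.
rewrite (sm_scalarD E x ms mt).
by rewrite [RHS]measure_addE.
Qed.

(** The scalar measure of E(s)x is carried by s, so t <= a holds almost everywhere. *)
Lemma sm_mean_le s x a : measurable s -> 0 <= a -> (forall t, s t -> t <= a) ->
  (sm_mean (E s x) <= (a * rip ip (E s x) (E s x))%:E)%E.
Proof.
move=> ms a0 sa; rewrite EFinM -(sm_scalar_total E) -integral_cst//.
apply: ae_ge0_le_integral => //.
exists (~` s); split; [exact: measurableC|exact: sm_scalarC|].
by move=> t /= nta st; apply: nta => _; rewrite lee_fin sa.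
Qed.

Lemma sm_mean_ge s x b : measurable s -> 0 <= b -> (forall t, s t -> b <= t) ->
  ((b * rip ip (E s x) (E s x))%:E <= sm_mean (E s x))%E.
Proof.
move=> ms b0 sb; rewrite EFinM -(sm_scalar_total E) -integral_cst//.
apply: ae_ge0_le_integral => //.
exists (~` s); split; [exact: measurableC|exact: sm_scalarC|].
by move=> t /= nta st; apply: nta => _; rewrite lee_fin sb.
Qed.

Variable T : oper H.
Hypotheses (Tsa : positive_selfadjoint ip T) (TT : odom T = setT)
  (TE : is_spectral_measure_of T E).

Let Tmean x y : T (x, y) -> (rip ip y x)%:E = sm_mean x.
Proof.
move=> Txy; rewrite /rip TE.2// /= /Rintegral fineK//.
by apply/sm_mean_fin/TE.1; rewrite TT.
Qed.

Let Tsym x y x' y' : T (x, y) -> T (x', y') -> rip ip y x' = rip ip x y'.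
Proof.
case: Tsa => _ _ Tadj _ Txy; rewrite -{1}Tadj => /(_ _ _ Txy) /= xy.
by rewrite /rip xy.
Qed.

(* e = f + g with f = E(s)e and g = E(R \ s)e; as <E(.)e, e> is the sum of
   <E(.)f, f> and <E(.)g, g>, the cross term Re <Tf, g> vanishes. *)
Lemma sm_mean_eigen (e : H) (r : R) s : T (e, r%:C%C *: e) -> measurable s ->
  sm_mean (E s e) = (r * rip ip (E s e) (E s e))%:E.
Proof.
move=> Te ms; have mC := measurableC ms.
pose f := E s e; pose g := E (~` s) e.
have eE : e = f + g := sm_setC E e ms.
have [f' Tf] : odom T f by rewrite TT.
have [g' Tg] : odom T g by rewrite TT.
have [[_ [Tlin Tfun]] _ _ _] := Tsa.
have reE : r%:C%C *: e = f' + g'.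
  apply: Tfun Te _; rewrite eE -(scale1r f) -(scale1r f').
  exact: Tlin.
have := Tmean Te; rewrite (sm_meanD e ms) -(Tmean Tf) -(Tmean Tg) -EFinD => -[].
rewrite reE {1}eE ripDr !ripDl (Tsym Tg Tf) (ripC ip g) => cross.
have {}cross : rip ip f' g = 0 by lra.
congr EFin; rewrite -/f -ripZr.
have -> : rip ip f (r%:C%C *: f) = rip ip f (r%:C%C *: e).
  rewrite !ripZr eE ripDr; congr (r * _).
  rewrite [X in _ + X](_ : _ = 0) ?addr0//.
  rewrite /f /g sm_rip// sm_disjoint//; first by rewrite /rip linear0r.
  exact/disj_set2P/setICr.
by rewrite -(Tsym Tf Te) [in RHS]eE ripDr cross addr0.
Qed.

(** The mean of E(s)e is r |E(s)e|^2 by [sm_mean_eigen] but at most a |E(s)e|^2, with a < r. *)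
Lemma sm_eigen_below (e : H) (r a : R) s : T (e, r%:C%C *: e) -> measurable s ->
  0 <= a -> a < r -> (forall t, s t -> t <= a) -> E s e = 0.
Proof.
move=> Te ms a0 ar sa; apply/eqP; rewrite -(rip_eq0 ip).
have := sm_mean_le e ms a0 sa; rewrite (sm_mean_eigen Te)// lee_fin.
by have := rip_ge0 ip (E s e); rewrite eq_le => -> /=; nra.
Qed.

Lemma sm_eigen_above (e : H) (r b : R) s : T (e, r%:C%C *: e) -> measurable s ->
  0 <= b -> r < b -> (forall t, s t -> b <= t) -> E s e = 0.
Proof.
move=> Te ms b0 br sb; apply/eqP; rewrite -(rip_eq0 ip).
have := sm_mean_ge e ms b0 sb; rewrite (sm_mean_eigen Te)// lee_fin.
by have := rip_ge0 ip (E s e); rewrite eq_le => -> /=; nra.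
Qed.

End spectral_integral.

(** * Eigenvectors of the modulus and a criterion against quasinormality *)

Section modulus.
Context {R : realType} {H : lmodType R[i]}.
Variable ip : {dot H for @Num.conj_op R[i]}.
Implicit Types (A T : oper H) (e : H) (r : R).

Lemma modulus_total A T : is_modulus ip A T ->
  odom (ocomp (adjoint ip A) A) = setT -> odom T = setT.
Proof.
move=> [_ TT] tot; apply/seteqP; split=> // x _.
by move: tot; rewrite -TT => /seteqP[_ /(_ x Logic.I)][z [y Txy _]]; exists y.
Qed.

(* (T + r)(T - r)e = 0 and T + r is injective since T >= 0 and r > 0. *)
Lemma modulus_eigen A T e r : is_modulus ip A T -> 0 < r ->
  ocomp (adjoint ip A) A (e, (r ^+ 2)%:C%C *: e) -> T (e, r%:C%C *: e).
Proof.
move=> [[[T0 [Tlin Tfun]] _ _ Tpos] TT] r0; rewrite -TT => -[y /= Tey Tye].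
suff -> : r%:C%C *: e = y by [].
apply/eqP; rewrite eq_sym -subr_eq0 -(rip_eq0 ip) eq_le rip_ge0 andbT.
have Tg : T (y - r%:C%C *: e, - r%:C%C *: (y - r%:C%C *: e)).
  have := Tlin (- r%:C%C) _ _ _ _ Tey Tye.
  rewrite scaleNr (addrC _ y) => Tg; congr (T (_, _)) : Tg.
  rewrite !scaleNr scalerBr opprB addrC scalerA; congr (_ *: _ - _).
  by rewrite expr2 rmorphM.
have := Tpos _ _ Tg; rewrite lecE => /andP[_].
rewrite scaleNr -/(rip ip _ _) ripNl ripZl /= oppr_ge0.
by rewrite pmulr_rle0.
Qed.

(** The vectors e and e' are eigenvectors of |A| for r < r', so the spectral projection of [0, a]
    with r < a < r' fixes e and kills e'. Commutation at e then gives y = E(s)y, whence <y, e'> =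
    <y, E(s)e'> = 0. *)
Lemma not_quasinormal A e e' y r r' : 0 < r -> r < r' ->
  odom (ocomp (adjoint ip A) A) = setT ->
  ocomp (adjoint ip A) A (e, (r ^+ 2)%:C%C *: e) ->
  ocomp (adjoint ip A) A (e', (r' ^+ 2)%:C%C *: e') ->
  A (e, y) -> ip y e' != 0 -> ~ quasinormal ip A.
Proof.
move=> r0 rr' tot Ae Ae' Aey ye' [[Aop _ _] [T [E [AT TE Ecom]]]].
have r'0 := lt_trans r0 rr'.
have [_ [_ Afun]] := Aop.
have TT := modulus_total AT tot.
have Te := modulus_eigen AT r0 Ae; have Te' := modulus_eigen AT r'0 Ae'.
have [Tsa _] := AT.
pose a := (r + r') / 2.
have [ra ar' a0] : [/\ r < a, a < r' & 0 <= a] by rewrite /a; split; lra.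
pose s : set R := `[0, a]%classic.
have ms : measurable s by exact: measurable_itv.
have E'0 : E s e' = 0.
  apply: (sm_eigen_below Tsa TT TE Te' ms a0 ar') => t.
  by rewrite /s /= in_itv /= => /andP[].
have Eee : E s e = e.
  have := sm_total E e.
  have -> : `[0, +oo[%classic = s `|` `]a, +oo[%classic.
    apply/seteqP; split=> t; rewrite /s /= !in_itv/= !andbT.
      by case: (leP t a) => ta t0; [left; rewrite t0|right].
    by move=> [/andP[]//|/ltW]; apply: le_trans.
  rewrite sm_union//.
    rewrite (sm_eigen_above Tsa TT TE Te (measurable_itv `]a, +oo[) a0 ra) ?addr0// => t.
    by rewrite /= in_itv/= andbT => /ltW.
  apply/disj_set2P/seteqP; split=> // t [].
  by rewrite /s /= !in_itv/= andbT => /andP[_ ta]; rewrite ltNge ta.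
have s0 : s `<=` `[0, +oo[%classic.
  by move=> t; rewrite /s /= !in_itv/= => /andP[->].
have /(Ecom s ms s0) : ocomp (ograph (E s)) A (e, E s y) by exists y.
move=> [z zE AeEy]; have {}zE : z = E s e := zE.
rewrite /= zE Eee in AeEy.
have yE := Afun _ _ _ Aey AeEy.
by move: ye'; rewrite yE sm_selfadjoint// E'0 linear0r eqxx.
Qed.

End modulus.

(** * Closedness of bounded operators and the algebra of graphs *)

Section bounded_operators.
Context {R : realType} {H : lmodType R[i]}.
Variable ip : {dot H for @Num.conj_op R[i]}.
Implicit Types (A B C : oper H) (x y : H).

Lemma hnorm_sq x : hnorm ip x ^+ 2 = rip ip x x.
Proof. by rewrite /hnorm sqr_sqrtr// -/(rip ip x x) rip_ge0. Qed.

Lemma hnorm_ge0 x : 0 <= hnorm ip x.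
Proof. exact: sqrtr_ge0. Qed.

Lemma rip_sqD_le x y :
  rip ip (x + y) (x + y) <= (rip ip x x + rip ip y y) *+ 2.
Proof.
have := rip_ge0 ip (x - y); rewrite !rip_sqD rip_sqN ripNr; lra.
Qed.

Lemma bounded_closed A : bounded_everywhere ip A -> closed_densely_defined ip A.
Proof.
move=> [[A0 [Alin Afun]] Atot [M AM]]; split=> //; last first.
  move=> x e e0; exists x; first by rewrite Atot.
  by rewrite subrr /hnorm linear0l sqrtr0.
move=> u v x y Auv ux vy.
have [z Axz] : odom A x by rewrite Atot.
suff -> : y = z by [].
apply/eqP; rewrite -subr_eq0 -(rip_eq0 ip) eq_le rip_ge0 andbT.
(* With z = Ax, this null sequence bounds |y - z|^2: write y - z = (v n - z) - (v n - y), where v n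
   - z = A(u n - x). *)
have lim0 : (hnorm ip (v n - y) ^+ 2 + M ^+ 2 * hnorm ip (u n - x) ^+ 2) *+ 2
    @[n --> \oo] --> ((0 ^+ 2 + M ^+ 2 * 0 ^+ 2) *+ 2 : R).
  have sq_cvg (f : nat -> R) :
      f @ \oo --> (0 : R) -> f n ^+ 2 @[n --> \oo] --> (0 ^+ 2 : R).
    by move=> f0; exact: (cvgM f0 f0).
  apply: cvgMn; apply: cvgD; first exact: sq_cvg.
  by apply: cvgM; [exact: cvg_cst|exact: sq_cvg].
rewrite expr0n/= mulr0 addr0 mul0rn in lim0.
rewrite -(cvg_lim _ lim0)//; apply: limr_ge; first by apply: cvgP lim0.
apply: nearW => n.
have Aux : A (u n - x, v n - z).
  have := Alin (-1) _ _ _ _ Axz (Auv n).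
  by rewrite !scaleN1r !(addrC (- _)).
have -> : y - z = (v n - z) + - (v n - y).
  by rewrite opprB [RHS]addrC addrA subrK.
apply: le_trans (rip_sqD_le _ _) _; rewrite rip_sqN lerMn2r /=.
rewrite addrC hnorm_sq lerD2l -exprMn -hnorm_sq ler_sqr ?nnegrE ?hnorm_ge0//.
  exact: AM.
exact: le_trans (hnorm_ge0 _) (AM _ _ Aux).
Qed.

Lemma ocompA A B C : ocomp A (ocomp B C) = ocomp (ocomp A B) C.
Proof.
apply/seteqP; split=> -[x y] /=.
  by move=> [z [t Cxt Btz] Azy]; exists t => //; exists z.
by move=> [t Cxt [z Btz Azy]]; exists z => //; exists t.
Qed.

Lemma ocomp_idl A : ocomp (ograph id) A = A.
Proof.
apply/seteqP; split=> -[x y] /=; first by move=> [z Axz yz]; have -> : y = z := yz.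
by move=> Axy; exists y.
Qed.

Lemma ocomp_idr A : ocomp A (ograph id) = A.
Proof.
apply/seteqP; split=> -[x y] /=; first by move=> [z zx]; have -> : z = x := zx.
by move=> Axy; exists x.
Qed.

Lemma opowS A n : opow A n.+1 = ocomp A (opow A n).
Proof. by []. Qed.

Lemma opowSr A n : opow A n.+1 = ocomp (opow A n) A.
Proof.
elim: n => [|n IH]; first by rewrite opowS ocomp_idr ocomp_idl.
by rewrite opowS {1}IH ocompA.
Qed.

End bounded_operators.

(** * Weighted composition operators on the tree *)

(* The children whose edges carry a nonzero weight: of the branches at 0, only
   the first two are used. *)
Definition heavy_children (u : Vinf) : seq Vinf :=
  match u with
  | Trunk 0 => [:: Branch 0 0; Branch 1 0]
  | Trunk k.+1 => [:: Trunk k]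
  | Branch i j => [:: Branch i j.+1]
  end.

Lemma heavy_children_uniq u : uniq (heavy_children u).
Proof. by case: u => [[|k]|i j]. Qed.

Lemma par_heavy_children u v : v \in heavy_children u -> par v = u.
Proof.
case: u => [[|k]|i j]; rewrite !inE; last 2 first.
- by move=> /eqP ->.
- by move=> /eqP ->.
by move=> /orP[] /eqP ->.
Qed.

(** * Integration over the vertices and change of variables along [par] *)

Section discrete_integral.
Context {R : realType}.
Variables (mu : {measure set Vinf -> \bar R}) (m : Vinf -> R).
Hypothesis mum : forall v, mu [set v] = (m v)%:E.
Implicit Types (f g : Vinf -> R) (D : set Vinf) (P : Vinf -> Prop).

Lemma Vinf_measurable_fun {d} {T : measurableType d} D (f : Vinf -> T) :
  measurable_fun D f.
Proof. by []. Qed.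

Lemma ae_Vinf P : {ae mu, forall v, P v} <-> forall v, m v != 0 -> P v.
Proof.
split=> [[N [mN N0 PN]] v|PV].
  apply: contra_neqP => Pv; apply: EFin_inj; rewrite -mum.
  apply/eqP; rewrite eq_le measure_ge0 andbT.
  apply: (@le_trans _ _ (mu N)); last by rewrite N0.
  by apply: le_measure; rewrite ?inE// => _ ->; exact: PN.
rewrite /almost_everywhere/= /prop_near1 nbhs_filterE.
(* The massless vertices are listed by their codes: each [F k] is empty or a massless singleton, and
   a countable union of negligible sets is negligible. *)
pose F k := [set v | m v = 0 /\ pickle v = k].
apply: (@negligibleS _ _ _ _ (\bigcup_k F k)).
  move=> v /= Pv; exists (pickle v) => //; split=> //.
  by apply/eqP; apply: contra_notT Pv; exact: PV.
apply: negligible_bigcup => k.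
exists (F k); split=> //.
have [[v [v0 vk]]|Fk] := pselect (exists v, F k v).
  rewrite (_ : F k = [set v]) ?mum ?v0//.
  apply/seteqP; split=> [w [_ wk]|_ ->//].
  by apply: (pcan_inj pickleK); rewrite wk vk.
rewrite (_ : F k = set0)//; apply/seteqP; split=> // v Fv.
by apply: Fk; exists v.
Qed.

Lemma ae_eq_Vinf {T} (f g : Vinf -> T) :
  f = g %[ae mu] <-> forall v, m v != 0 -> f v = g v.
Proof.
split=> [/ae_Vinf fg v /fg|fg]; first exact.
by apply/ae_Vinf => v /fg.
Qed.

Lemma eq_Rintegral_Vinf f g : (forall v, m v != 0 -> f v = g v) ->
  \int[mu]_v f v = \int[mu]_v g v.
Proof.
move=> fg; congr fine; apply: ae_eq_integral => //.
by apply/ae_eq_Vinf => v /fg /= ->.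
Qed.

Lemma integral_delta D f v : 0 <= f v -> D v ->
  (\int[mu]_(x in D) (f v * \1_[set v] x)%:E = (f v * m v)%:E)%E.
Proof.
move=> f0 Dv; under eq_integral do rewrite EFinM.
rewrite ge0_integralZl//.
rewrite integral_indic// EFinM -mum; congr (_ * mu _)%E.
by apply/seteqP; split=> [x []//|_ ->].
Qed.

Section change_of_variables.
Variables q k : Vinf -> R.
Hypotheses (q0 : forall v, 0 <= q v) (k0 : forall v, 0 <= k v).
Hypothesis q_heavy : forall v, v \notin heavy_children (par v) ->
  m v * q v = 0.
Hypothesis kE : forall u,
  k u * m u = \sum_(v <- heavy_children u) m v * q v.

(** Only the finitely many heavy children of u carry q-mass in the fiber, so the integrand is almost
    everywhere a finite sum of multiples of indicators, which [kE] evaluates. *)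
Let integral_fiber f u : (forall v, 0 <= f v) ->
  (\int[mu]_(v in [set v | par v = u]) (q v * f (par v))%:E =
   \int[mu]_(v in [set u]) (k v * f v)%:E)%E.
Proof.
move=> f0.
have qf0 v : 0 <= q v * f (par v) by exact: mulr_ge0.
transitivity (\int[mu]_(x in [set v | par v = u])
    \sum_(v <- heavy_children u) (q v * f (par v) * \1_[set v] x)%:E)%E.
  apply: ae_eq_integral => //; apply/ae_Vinf => x mx /= xu.
  have [xch|xch] := boolP (x \in heavy_children u).
    rewrite (bigD1_seq x)//= ?heavy_children_uniq//.
    rewrite indicE mem_set// mulr1 big1 ?adde0// => v vx.
    rewrite indicE memNset ?mulr0// => /esym/eqP.
    exact/negP.
  have := q_heavy; rewrite -xu in xch.
  move=> /(_ x xch)/eqP; rewrite mulf_eq0 (negPf mx) => /eqP ->.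
  rewrite mul0r big_seq big1// => v vch.
  rewrite indicE memNset ?mulr0// => /esym/eqP /eqP vx.
  by move: xch; rewrite xu -vx vch.
rewrite ge0_integral_sum//; last first.
  by move=> v x _; rewrite lee_fin mulr_ge0.
transitivity (\sum_(v <- heavy_children u) (q v * f (par v) * m v)%:E)%E.
  rewrite big_seq [RHS]big_seq; apply: eq_bigr => v /par_heavy_children vu.
  by rewrite (integral_delta (f := fun v => q v * f (par v))).
transitivity (\int[mu]_(v in [set u]) (k u * f u * \1_[set u] v)%:E)%E.
  rewrite (integral_delta (f := fun v => k v * f v))//; last exact: mulr_ge0.
  rewrite sumEFin; congr EFin; rewrite mulrAC kE mulr_suml.
  rewrite big_seq [RHS]big_seq; apply: eq_bigr => v /par_heavy_children ->.
  ring.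
apply: eq_integral => v; rewrite inE => ->.
by rewrite indicE mem_set// mulr1.
Qed.

(** By [q_heavy] and [kE], the measure k m is the image of q m under [par]. Both integrals are cut
    into pieces indexed by the code of the parent, respectively of the vertex, and compared fiber by
    fiber. *)
Lemma ge0_integral_par f : (forall v, 0 <= f v) ->
  (\int[mu]_v (q v * f (par v))%:E = \int[mu]_v (k v * f v)%:E)%E.
Proof.
move=> f0.
pose F i := [set v | pickle (par v) = i].
pose G i := [set v : Vinf | pickle v = i].
have FT : \bigcup_i F i = setT.
  by apply/seteqP; split=> // v _; exists (pickle (par v)).
have GT : \bigcup_i G i = setT.
  by apply/seteqP; split=> // v _; exists (pickle v).
rewrite -{1}FT -GT !ge0_integral_bigcup//; last 4 first.
- by move=> v _; rewrite lee_fin mulr_ge0.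
- by move=> i j _ _ [v [<- <-]].
- by move=> v _; rewrite lee_fin mulr_ge0.
- by move=> i j _ _ [v [<- <-]].
apply: eq_eseriesr => i _.
have [[u ui]|Gi] := pselect (exists u, G i u).
  have pickle_u v : pickle v = i <-> v = u.
    by rewrite -ui; split=> [/(pcan_inj pickleK)|->].
  have -> : F i = [set v | par v = u] by apply/seteqP; split=> v /pickle_u.
  have -> : G i = [set u] by apply/seteqP; split=> v /pickle_u.
  exact: integral_fiber.
have -> : F i = set0.
  by apply/seteqP; split=> // v Fv; apply: Gi; exists (par v).
have -> : G i = set0 by apply/seteqP; split=> // v Gv; apply: Gi; exists v.
by rewrite !integral_set0.
Qed.

(* The positive and the negative parts of the two integrands have equal
   integrals, so the identity covers the default values at non-integrable f. *)
Lemma Rintegral_par f :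
  \int[mu]_v (q v * f (par v)) = \int[mu]_v (k v * f v).
Proof.
congr fine; rewrite integralE [in RHS]integralE.
have posM (a b : R) : 0 <= a ->
    maxe (a * b)%:E 0%E = (a * Num.max b 0)%:E.
  by move=> a0; rewrite maxr_pMr// mulr0 EFin_max.
have negM (a b : R) : 0 <= a ->
    maxe (- (a * b)%:E)%E 0%E = (a * Num.max (- b) 0)%:E.
  by move=> a0; rewrite -EFinN -mulrN posM.
have le0max (b : R) : 0 <= Num.max b 0 by rewrite le_max lexx orbT.
congr (_ - _)%E.
- under eq_integral do rewrite funeposE posM//.
  under [RHS]eq_integral do rewrite funeposE posM//.
  exact: (ge0_integral_par (f := fun v => Num.max (f v) 0)).
- under eq_integral do rewrite funenegE negM//.
  under [RHS]eq_integral do rewrite funenegE negM//.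
  exact: (ge0_integral_par (f := fun v => Num.max (- f v) 0)).
Qed.

End change_of_variables.

End discrete_integral.

(** * Elements of L2 as functions on the vertices of nonzero mass *)

Section L2_Vinf.
Context {R : realType}.
Variables (mu : {measure set Vinf -> \bar R}) (m : Vinf -> R).
Hypothesis mum : forall v, mu [set v] = (m v)%:E.
Implicit Types (x y z : L2 mu) (rho : Vinf -> R).

Definition sqmod (c : R[i]) : R := complex.Re c ^+ 2 + complex.Im c ^+ 2.

Lemma sqmod_ge0 c : 0 <= sqmod c.
Proof. by rewrite addr_ge0 ?sqr_ge0. Qed.

Lemma sqmodM (r : R) c : sqmod (r%:C%C * c) = r ^+ 2 * sqmod c.
Proof. by case: c => u v; rewrite /sqmod /=; ring. Qed.

Lemma L2_Vinf_ext x y :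
  (forall v, m v != 0 -> L2_fun x v = L2_fun y v) -> x = y.
Proof.
move=> xy; rewrite -[x]reprK -[y]reprK; apply/L2_eqP.
exact/(ae_eq_Vinf mum).
Qed.

Lemma L2_Vinf_ex (f : Vinf -> R[i]) :
  (\int[mu]_v (sqmod (f v))%:E < +oo)%E ->
  exists x : L2 mu, forall v, m v != 0 -> L2_fun x v = f v.
Proof.
move=> foo.
have fP : f \in sqint_pred mu by apply/asboolP.
exists (\pi_(L2 mu) (MkL2fun fP))%qT.
exact/(ae_eq_Vinf mum)/repr_pi.
Qed.

Lemma L2_Vinf_sqint x : (\int[mu]_v (sqmod (L2_fun x v))%:E < +oo)%E.
Proof. by have [] := L2_fun_sqint x. Qed.

Lemma L2_Vinf_lin c x y v : m v != 0 ->
  L2_fun (c *: x + y) v = c * L2_fun x v + L2_fun y v.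
Proof. by move: v; exact/(ae_eq_Vinf mum)/L2_fun_lin. Qed.

Lemma L2_Vinf_0 v : m v != 0 -> L2_fun (0 : L2 mu) v = 0.
Proof.
move=> mv; have := @L2_Vinf_lin (-1) 0 0 v mv.
by rewrite scaler0 addr0 mulN1r addNr.
Qed.

Lemma L2_Vinf_Z c x v : m v != 0 -> L2_fun (c *: x) v = c * L2_fun x v.
Proof.
by move=> mv; rewrite -[c *: x]addr0 L2_Vinf_lin// L2_Vinf_0// addr0.
Qed.

Lemma L2_Vinf_delta u :
  exists e : L2 mu, forall v, m v != 0 -> L2_fun e v = (v == u)%:R.
Proof.
apply: L2_Vinf_ex.
have -> : (\int[mu]_v (sqmod ((v == u)%:R : R[i]))%:E =
    \int[mu]_v (1 * \1_[set u] v)%:E)%E.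
  apply: eq_integral => v _; rewrite mul1r; congr EFin.
  rewrite indicE; have [->|vu] := eqVneq v u.
    by rewrite mem_set// /sqmod /=; ring.
  rewrite memNset; last by move/eqP: vu.
  by rewrite /sqmod /=; ring.
by rewrite (integral_delta mum (f := fun=> 1))// mul1r ltry.
Qed.

Lemma L2dot_delta e u y : (forall v, m v != 0 -> L2_fun e v = (v == u)%:R) ->
  L2dot y e = (m u)%:C%C * L2_fun y u.
Proof.
move=> eE; rewrite /L2dot /cintegral.
have intE (b : R) :
    \int[mu]_v (b * \1_[set u] v) = m u * b.
  have one : mu.-integrable setT (EFin \o (\1_[set u] : Vinf -> R)).
    apply/integrableP; split=> //.
    have -> : (\int[mu]_v `|(EFin \o \1_[set u]) v| =
        \int[mu]_v (1 * \1_[set u] v)%:E)%E.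
      by apply: eq_integral => v _; rewrite /= mul1r ger0_norm.
    by rewrite (integral_delta mum (f := fun=> 1))// mul1r ltry.
  rewrite RintegralZl// mulrC; congr (_ * b).
  have := integral_delta mum (D := setT) (f := fun=> 1) ler01 (v := u) Logic.I.
  under eq_integral do rewrite /= mul1r.
  by rewrite /Rintegral mul1r => ->.
have E v : m v != 0 -> L2_fun y v * (L2_fun e v)^* =
    L2_fun y u * (\1_[set u] v)%:C%C.
  move=> mv; rewrite eE// conjC_nat indicE rmorph_nat classical_sets.in_set1.
  by have [->|] := eqVneq v u; rewrite ?mulr0.
have -> : \int[mu]_v complex.Re (L2_fun y v * (L2_fun e v)^*) =
    m u * complex.Re (L2_fun y u).
  rewrite -intE; apply: (eq_Rintegral_Vinf mum) => v mv.
  by rewrite E//; case: (L2_fun y u) => p q /=; ring.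
have -> : \int[mu]_v complex.Im (L2_fun y v * (L2_fun e v)^*) =
    m u * complex.Im (L2_fun y u).
  rewrite -intE; apply: (eq_Rintegral_Vinf mum) => v mv.
  by rewrite E//; case: (L2_fun y u) => p q /=; ring.
case: (L2_fun y u) => p q.
by apply/eqP; rewrite eq_complex /=; apply/andP; split; apply/eqP; ring.
Qed.

End L2_Vinf.

(** * Weighted composition operators, their adjoints and powers *)

Section weighted_composition.
Context {R : realType}.
Variables (mu : {measure set Vinf -> \bar R}) (m : Vinf -> R).
Hypothesis mum : forall v, mu [set v] = (m v)%:E.
Implicit Types (w a rho : Vinf -> R).

Definition weighted_composition w : oper (L2 mu) :=
  [set p | forall v, m v != 0 -> L2_fun p.2 v = (w v)%:C%C * L2_fun p.1 (par v)].

Definition mulop rho : oper (L2 mu) :=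
  [set p | forall v, m v != 0 -> L2_fun p.2 v = (rho v)%:C%C * L2_fun p.1 v].

Definition tree_op a rho (u : Vinf) : R :=
  \sum_(v <- heavy_children u) a v * rho v.

Definition bounded_weight rho := exists K, forall v, 0 <= rho v <= K.

Lemma mulop_ex rho x : bounded_weight rho -> exists y, mulop rho (x, y).
Proof.
move=> [K rhoK].
have [|y yE] := L2_Vinf_ex mum (f := fun v => (rho v)%:C%C * L2_fun x v);
  last by exists y.
apply: (@le_lt_trans _ _ (\int[mu]_v ((K ^+ 2)%:E * (sqmod (L2_fun x v))%:E))%E).
  apply: ge0_le_integral => //.
  - by move=> v _; rewrite lee_fin sqmod_ge0.
  - move=> v _; rewrite -EFinM lee_fin sqmodM ler_wpM2r ?sqmod_ge0//.
    by have /andP[r0 rK] := rhoK v; rewrite ler_sqr ?nnegrE// (le_trans r0).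
rewrite ge0_integralZl//; last 2 first.
- by move=> v _; rewrite lee_fin sqmod_ge0.
- by rewrite lee_fin sqr_ge0.
have xoo := L2_Vinf_sqint x.
rewrite -[X in (_ * X)%E]fineK ?ge0_fin_numE ?integral_ge0//.
  by rewrite -EFinM ltry.
by move=> v _; rewrite lee_fin sqmod_ge0.
Qed.

Lemma mulop1 : mulop (fun=> 1) = ograph id.
Proof.
apply/seteqP; split=> -[x y] /= xy.
  by apply: (L2_Vinf_ext mum) => v mv; rewrite [LHS]xy// rmorph1 mul1r.
by move=> v mv /=; rewrite [y]xy rmorph1 mul1r.
Qed.

Lemma mulop_comp rho rho' : bounded_weight rho' ->
  ocomp (mulop rho) (mulop rho') = mulop (fun v => rho v * rho' v).
Proof.
move=> rho'b; apply/seteqP; split=> -[x z] /=.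
  move=> [y xy yz] v mv /=.
  by rewrite [LHS]yz// [in LHS]xy// mulrA rmorphM.
move=> xz; have [y xy] := mulop_ex x rho'b; exists y => // v mv /=.
by rewrite [LHS]xz// [in RHS]xy// mulrA rmorphM.
Qed.

Lemma mulop_inj rho rho' : bounded_weight rho -> mulop rho = mulop rho' ->
  forall v, m v != 0 -> rho v = rho' v.
Proof.
move=> rhob rr' v mv; have [e eE] := L2_Vinf_delta mum v.
have [y ey] := mulop_ex e rhob.
have := ey; rewrite rr' => ey'.
have := ey v mv; rewrite [LHS]ey'//= eE// eqxx !mulr1 => -[].
by [].
Qed.

Variables a w : Vinf -> R.
Hypotheses (a0 : bounded_weight a)
  (a_heavy : forall v, v \notin heavy_children (par v) -> a v = 0)
  (amw : forall v, m v * w v ^+ 2 = m (par v) * a v).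

Let A := weighted_composition w.
Let T := tree_op a.
Let Aa := adjoint L2dot A.

Lemma tree_op_bounded rho : bounded_weight rho -> bounded_weight (T rho).
Proof.
move=> [K rhoK]; have [M aM] := a0.
have K0 : 0 <= K by have /andP[] := rhoK (Trunk 0); apply: le_trans.
have M0 : 0 <= M by have /andP[] := aM (Trunk 0); apply: le_trans.
have term v : 0 <= a v * rho v <= M * K.
  have /andP[a_ge0 a_le] := aM v; have /andP[rho_ge0 rho_le] := rhoK v.
  by rewrite mulr_ge0//= ler_pM.
(* The factor 2 is the largest number of heavy children, attained at the vertex 0. *)
exists ((M * K) *+ 2) => u; rewrite /T /tree_op mulr2n.
have MK0 : 0 <= M * K by rewrite mulr_ge0.
case: u => [[|k]|i j] /=; rewrite !big_cons big_nil addr0.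
- have /andP[? ?] := term (Branch 0 0); have /andP[? ?] := term (Branch 1 0).
  by rewrite addr_ge0//= lerD.
- by have /andP[-> ?] := term (Trunk k); rewrite /= ler_wpDr.
- by have /andP[-> ?] := term (Branch i j.+1); rewrite /= ler_wpDr.
Qed.

Let bounded_weight1 : bounded_weight (fun=> 1).
Proof. by exists 1 => v; rewrite ler01 lexx. Qed.

Lemma iter_tree_op_bounded rho n : bounded_weight rho ->
  bounded_weight (iter n T rho).
Proof. by move=> rhob; elim: n => //= n; exact: tree_op_bounded. Qed.

(** Supplies the hypotheses of the change of variables for q = rho w^2 and k = T rho; [amw] turns
    m(v) w(v)^2 into m(par v) a(v). *)
Let qk rho : bounded_weight rho ->
  [/\ forall v, 0 <= rho v * w v ^+ 2, forall v, 0 <= T rho v,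
      forall v, v \notin heavy_children (par v) -> m v * (rho v * w v ^+ 2) = 0 &
      forall u, T rho u * m u =
        \sum_(v <- heavy_children u) m v * (rho v * w v ^+ 2)].
Proof.
move=> rhob; have [K rhoK] := rhob.
have [K' TrhoK] := tree_op_bounded rhob.
split.
- by move=> v; have /andP[? _] := rhoK v; rewrite mulr_ge0 ?sqr_ge0.
- by move=> v; have /andP[] := TrhoK v.
- by move=> v vh; rewrite mulrCA amw a_heavy// !mulr0.
- move=> u; rewrite /T /tree_op mulr_suml big_seq [RHS]big_seq.
  apply: eq_bigr => v /par_heavy_children vu.
  by rewrite mulrCA amw vu; ring.
Qed.

Lemma weighted_composition_ex x : exists y, A (x, y).
Proof.
have [q0 k0 qh kE] := qk bounded_weight1.
have [|y yE] := L2_Vinf_ex mum (f := fun v => (w v)%:C%C * L2_fun x (par v));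
  last by exists y.
have -> : (\int[mu]_v (sqmod ((w v)%:C%C * L2_fun x (par v)))%:E =
    \int[mu]_v (T (fun=> 1) v * sqmod (L2_fun x v))%:E)%E.
  rewrite -(ge0_integral_par mum q0 k0 qh kE (f := fun v => sqmod (L2_fun x v))).
    by apply: eq_integral => v _; rewrite sqmodM mul1r.
  by move=> v; exact: sqmod_ge0.
have [K TK] := tree_op_bounded bounded_weight1.
have K0 : 0 <= K by have /andP[] := TK (Trunk 0); apply: le_trans.
apply: (@le_lt_trans _ _ (\int[mu]_v (K%:E * (sqmod (L2_fun x v))%:E))%E).
  apply: ge0_le_integral => //.
  - by move=> v _; rewrite lee_fin mulr_ge0 ?sqmod_ge0.
  - move=> v _; rewrite -EFinM lee_fin ler_wpM2r ?sqmod_ge0//.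
    by have /andP[] := TK v.
rewrite ge0_integralZl//; last by move=> v _; rewrite lee_fin sqmod_ge0.
have xoo := L2_Vinf_sqint x.
rewrite -[X in (_ * X)%E]fineK ?ge0_fin_numE ?integral_ge0//.
  by rewrite -EFinM ltry.
by move=> v _; rewrite lee_fin sqmod_ge0.
Qed.

(** Makes A independent of representatives: the value at [par v] enters with a nonzero factor only
    where [par v] has nonzero mass. *)
Let par_weight v : m v != 0 -> w v != 0 -> m (par v) != 0.
Proof.
move=> mv wv; have : m v * w v ^+ 2 != 0 by rewrite mulf_neq0// sqrf_eq0.
by rewrite amw mulf_eq0 negb_or => /andP[].
Qed.

Lemma weighted_composition_operator : is_operator A.
Proof.
split; [|split].
- move=> v mv /=; rewrite (L2_Vinf_0 mum)//.
  have [->|wv] := eqVneq (w v) 0; first by rewrite rmorph0 mul0r.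
  by rewrite (L2_Vinf_0 mum) ?mulr0// par_weight.
- move=> c x y z t xy zt v mv /=.
  rewrite (L2_Vinf_lin mum)// [in LHS]xy// [in LHS]zt//=.
  have [->|wv] := eqVneq (w v) 0; first by rewrite rmorph0 !mul0r mulr0 addr0.
  by rewrite (L2_Vinf_lin mum) ?par_weight// mulrDr mulrCA.
- move=> x y z xy xz; apply: (L2_Vinf_ext mum) => v mv.
  by rewrite [LHS]xy// [RHS]xz.
Qed.

(** This is <Ax', rho Ax> = <x', (T rho)x>, obtained by the change of variables in the real and
    imaginary parts separately. *)
Lemma weighted_composition_dot rho x y z x' z' : bounded_weight rho ->
  A (x', y) -> ocomp (mulop rho) A (x, z) -> mulop (T rho) (x, z') ->
  L2dot y z = L2dot x' z'.
Proof.
move=> rhob x'y [t xt tz] xz'.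
have [q0 k0 qh kE] := qk rhob.
have lhsE v : m v != 0 -> L2_fun y v * (L2_fun z v)^* =
    (rho v * w v ^+ 2)%:C%C * (L2_fun x' (par v) * (L2_fun x (par v))^*).
  move=> mv; rewrite [L2_fun y v]x'y// [L2_fun z v]tz// [L2_fun t v]xt//=.
  case: (L2_fun x _) (L2_fun x' _) => [p q] [p' q'].
  by apply/eqP; rewrite eq_complex /=; apply/andP; split; apply/eqP; ring.
have rhsE v : m v != 0 -> L2_fun x' v * (L2_fun z' v)^* =
    (T rho v)%:C%C * (L2_fun x' v * (L2_fun x v)^*).
  move=> mv; rewrite [L2_fun z' v]xz'//=.
  case: (L2_fun x _) (L2_fun x' _) => [p q] [p' q'].
  by apply/eqP; rewrite eq_complex /=; apply/andP; split; apply/eqP; ring.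
have ReZ (c : R) (d : R[i]) : complex.Re (c%:C%C * d) = c * complex.Re d.
  by case: d => d d' /=; ring.
have ImZ (c : R) (d : R[i]) : complex.Im (c%:C%C * d) = c * complex.Im d.
  by case: d => d d' /=; ring.
rewrite /L2dot /cintegral; congr (_ +i* _)%C.
  transitivity (\int[mu]_v (rho v * w v ^+ 2 *
      complex.Re (L2_fun x' (par v) * (L2_fun x (par v))^*))).
    by apply: (eq_Rintegral_Vinf mum) => v mv; rewrite lhsE// ReZ.
  rewrite (Rintegral_par mum q0 k0 qh kE
    (fun v => complex.Re (L2_fun x' v * (L2_fun x v)^*))).
  by apply: (eq_Rintegral_Vinf mum) => v mv; rewrite rhsE// ReZ.
transitivity (\int[mu]_v (rho v * w v ^+ 2 *
    complex.Im (L2_fun x' (par v) * (L2_fun x (par v))^*))).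
  by apply: (eq_Rintegral_Vinf mum) => v mv; rewrite lhsE// ImZ.
rewrite (Rintegral_par mum q0 k0 qh kE
  (fun v => complex.Im (L2_fun x' v * (L2_fun x v)^*))).
by apply: (eq_Rintegral_Vinf mum) => v mv; rewrite rhsE// ImZ.
Qed.

Lemma adjoint_mulop_composition rho : bounded_weight rho ->
  ocomp Aa (ocomp (mulop rho) A) = mulop (T rho).
Proof.
move=> rhob; have Trhob := tree_op_bounded rhob.
apply/seteqP; split=> -[x z] /=.
  move=> [t xt tz]; have [z' xz'] := mulop_ex x Trhob.
  suff -> : z = z' by [].
  (* The adjoint relation is tested on z - z' itself: <z - z', z> = <A(z - z'), t> = <z - z',
     z'>. *)
  apply/eqP; rewrite -subr_eq0 -(dnorm_eq0 (@L2dot _ _ _ mu)) linearBr subr_eq0.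
  have [y Ay] := weighted_composition_ex (z - z').
  apply/eqP; apply: etrans (weighted_composition_dot rhob Ay xt xz').
  exact/esym/tz.
move=> xz'; have [y xy] := weighted_composition_ex x.
have [t yt] := mulop_ex y rhob.
have xt : ocomp (mulop rho) A (x, t) by exists y.
by exists t => // x' y' x'y'; exact: (weighted_composition_dot rhob x'y' xt xz').
Qed.

Lemma adjoint_composition : ocomp Aa A = mulop (T (fun=> 1)).
Proof. by rewrite -adjoint_mulop_composition// mulop1 ocomp_idl. Qed.

(** Splitting off the outermost adjoint and the innermost A leaves, by induction, multiplication by
    T^n rho between them. *)
Lemma adjoint_opow_mulop n rho : bounded_weight rho ->
  ocomp (opow Aa n) (ocomp (mulop rho) (opow A n)) = mulop (iter n T rho).
Proof.
move=> rhob; elim: n => [|n IH]; first by rewrite ocomp_idl ocomp_idr.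
rewrite (opowSr A) (opowS Aa) -ocompA (ocompA (mulop rho)) (ocompA (opow Aa n)) IH.
exact: adjoint_mulop_composition (iter_tree_op_bounded n rhob).
Qed.

Lemma adjoint_opow n : ocomp (opow Aa n) (opow A n) = mulop (iter n T (fun=> 1)).
Proof. by rewrite -adjoint_opow_mulop// mulop1 ocomp_idl. Qed.

Lemma opow_adjoint_composition n :
  opow (ocomp Aa A) n = mulop (fun v => T (fun=> 1) v ^+ n).
Proof.
rewrite adjoint_composition.
elim: n => [|n IH]; first by rewrite [LHS](esym mulop1).
rewrite opowS IH mulop_comp; first by congr mulop; apply/funext => v; rewrite exprS.
have [K TK] := tree_op_bounded bounded_weight1.
exists (K ^+ n) => v; have /andP[T0 TvK] := TK v.
by rewrite exprn_ge0//= lerXn2r// nnegrE// (le_trans T0).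
Qed.

Lemma bounded_weighted_composition : bounded_everywhere L2dot A.
Proof.
split; first exact: weighted_composition_operator.
  by apply/seteqP; split=> // x _; exact: weighted_composition_ex.
have Tb := tree_op_bounded bounded_weight1; have [K TK] := Tb.
have K0 : 0 <= K by have /andP[] := TK (Trunk 0); apply: le_trans.
exists (Num.sqrt K) => x y xy.
rewrite -ler_sqr ?nnegrE ?mulr_ge0 ?sqrtr_ge0 ?hnorm_ge0//.
rewrite exprMn !hnorm_sq sqr_sqrtr//.
have [z' xz'] := mulop_ex x Tb.
have xy1 : ocomp (mulop (fun=> 1)) A (x, y) by exists y; rewrite ?mulop1.
have yE : rip (@L2dot _ _ _ mu) y y = rip (@L2dot _ _ _ mu) x z'.
  congr complex.Re.
  exact: (weighted_composition_dot bounded_weight1 xy xy1 xz').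
(* As |Ax|^2 = <x, (T 1)x>, the difference K |x|^2 - |Ax|^2 is the integral of (K - T 1)|x|^2. *)
rewrite yE -subr_ge0 -ripZr -ripNr -ripDr.
rewrite -[rip _ _ _]/(\int[mu]_v
  complex.Re (L2_fun x v * (L2_fun (K%:C%C *: x - z') v)^*)).
rewrite (eq_Rintegral_Vinf mum (g := fun v => (K - T (fun=> 1) v) * sqmod (L2_fun x v))).
  apply: Rintegral_ge0 => v _; rewrite mulr_ge0 ?sqmod_ge0// subr_ge0.
  by have /andP[] := TK v.
move=> v mv.
have -> : L2_fun (K%:C%C *: x - z') v = (K - T (fun=> 1) v)%:C%C * L2_fun x v.
  by rewrite (L2_Vinf_lin mum)// -scaleN1r (L2_Vinf_Z mum)// [L2_fun z' v]xz'//
    mulN1r rmorphB mulrBl.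
by case: (L2_fun x v) => p q; rewrite /sqmod /=; ring.
Qed.

Lemma weighted_composition_inj :
  (forall u, exists2 v, par v = u & a v != 0) -> oinjective A.
Proof.
move=> a_neq0 x z y xy zy; apply: (L2_Vinf_ext mum) => u mu0.
have [v vu av] := a_neq0 u.
have : m v * w v ^+ 2 != 0 by rewrite amw vu mulf_neq0.
rewrite mulf_eq0 sqrf_eq0 negb_or => /andP[mv wv].
have := xy v mv; rewrite [LHS]zy//= vu => /mulfI -> //.
by rewrite -(rmorph0 (real_complex R)) (inj_eq (@complexI _)).
Qed.

(** The indicators of u and v are eigenvectors of A^* A for (T 1)(u) < (T 1)(v), and <A e_u, e_v> =
    m(v) w(v) is nonzero. *)
Lemma weighted_composition_not_quasinormal u v : par v = u -> m u != 0 ->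
  a v != 0 -> 0 < T (fun=> 1) u -> T (fun=> 1) u < T (fun=> 1) v ->
  ~ quasinormal L2dot A.
Proof.
move=> vu mu0 av Tu Tuv.
have : m v * w v ^+ 2 != 0 by rewrite amw vu mulf_neq0.
rewrite mulf_eq0 sqrf_eq0 negb_or => /andP[mv wv].
have Tv := lt_trans Tu Tuv.
have [e eE] := L2_Vinf_delta mum u; have [e' e'E] := L2_Vinf_delta mum v.
have [y ey] := weighted_composition_ex e.
have eigen t f : (forall x, m x != 0 -> L2_fun f x = (x == t)%:R) ->
    0 < T (fun=> 1) t ->
    ocomp Aa A (f, (Num.sqrt (T (fun=> 1) t) ^+ 2)%:C%C *: f).
  move=> fE T0; rewrite adjoint_composition => x mx /=.
  rewrite (L2_Vinf_Z mum)// fE// sqr_sqrtr 1?ltW//.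
  by have [->//|_] := eqVneq x t; rewrite !mulr0.
apply: (not_quasinormal (r := Num.sqrt (T (fun=> 1) u))
  (r' := Num.sqrt (T (fun=> 1) v)) _ _ _ (eigen u e eE Tu) (eigen v e' e'E Tv) ey).
- by rewrite sqrtr_gt0.
- by rewrite ltr_sqrt.
- apply/seteqP; split=> // x _; rewrite adjoint_composition.
  exact/mulop_ex/tree_op_bounded.
- rewrite [X in X != 0](L2dot_delta mum y e'E) [L2_fun y v]ey//= vu eE// eqxx mulr1.
  by rewrite -rmorphM -(rmorph0 (real_complex R)) (inj_eq (@complexI _)) mulf_neq0.
Qed.

End weighted_composition.

(** * The weights *)

Section point_masses.
Context {R : realType}.
Variable M : Vinf -> {nonneg R}.

Definition point_mass (k : nat) : {measure set Vinf -> \bar R} :=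
  if pickle_inv k is Some v then mscale (M v) (dirac v) else mzero.

Definition point_masses : set Vinf -> \bar R := mseries point_mass 0.

HB.instance Definition _ := Measure.on point_masses.

Lemma point_masses1 v : point_masses [set v] = ((M v)%:num)%:E.
Proof.
rewrite /point_masses /= /mseries (nneseriesD1 (n := pickle v))//.
rewrite eseries0 => [|k _ /= kv].
  rewrite adde0 /point_mass pickleK_inv /= /mscale /= diracE mem_set// mule1.
  by [].
rewrite /point_mass; have := pickle_invK (T := Vinf) k.
case: pickle_inv => [w /= wk|//].
rewrite /= /mscale /= diracE memNset ?mule0// => /= wv.
by move: kv; rewrite -wk wv eqxx.
Qed.

Lemma sigma_finite_point_masses : sigma_finite setT point_masses.
Proof.
exists (fun k => [set v | pickle v = k]).
  by apply/seteqP; split=> // v _; exists (pickle v).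
move=> k; split=> //.
have [[v vk]|Fk] := pselect (exists v : Vinf, pickle v = k).
  rewrite (_ : [set v | _] = [set v]) ?point_masses1 ?ltry//.
  apply/seteqP; split=> [w wk|_ ->//].
  by apply: (pcan_inj pickleK); rewrite wk vk.
rewrite (_ : [set v | _] = set0) ?measure0//.
by apply/seteqP; split=> // v vk; apply: Fk; exists v.
Qed.

HB.instance Definition _ := @Measure_isSigmaFinite.Build _ _ _ point_masses
  sigma_finite_point_masses.

End point_masses.

Lemma counting1 {R : realType} (v : Vinf) :
  counting [set v] = (1 : R)%:E.
Proof.
by rewrite /counting asboolT ?finite_set1// fset_set1 finmap.cardfs1.
Qed.

(** * Weights and masses for the exponent n = N + 1 *)

Section weights.
Context {R : realType}.
Variable N : nat.
Hypothesis N0 : (0 < N)%N.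

Let D : R := 2 ^+ N + 1.

Let D0 : 0 < D.
Proof. by rewrite addr_gt0 ?exprn_gt0. Qed.

(** These are the values t_i. Branches with i >= 2 are cut off at 0 by a zero root weight, but their
    nonzero weights further on keep the operator injective. *)
Definition branch_weight (i : nat) : R := if i is 0 then 2^-1 else 2.

(* The law P(t = 1/2) = 2^N/(2^N + 1), P(t = 2) = 1/(2^N + 1) satisfies
   E[t^j] = 1 exactly for j = 0 and j = N. *)
Definition root_weight (i : nat) : R :=
  match i with 0 => 2 ^+ N / D | 1 => D^-1 | _ => 0 end.

(** For k >= 1 this is E[t^(k-1)]: a path of k edges from 0 has one root edge and k - 1 edges of
    weight t. *)
Definition root_norm (k : nat) : R :=
  if k is j.+1 then
    root_weight 0 * branch_weight 0 ^+ j + root_weight 1 * branch_weight 1 ^+ j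
  else 1.

Definition nth_root (x : R) : R := x `^ N%:R^-1.

(** Prepending an edge of weight c to the sequence s gives c s(k-1) at k >= 1. Equality of the value
    c s(N) at N + 1 with the power c^(N+1) of the value at 1 forces c^N = s(N). *)
Definition trunk_step (s : nat -> R) (k : nat) : R :=
  if k is j.+1 then nth_root (s N) * s j else 1.

(* trunk_norm m k is the square of the norm of S^k e_(-m). *)
Definition trunk_norm (m : nat) : nat -> R := iter m trunk_step root_norm.

(** The weight of the edge entering v; it is the square of the corresponding shift weight. *)
Definition weight (v : Vinf) : R :=
  match v with
  | Trunk m => nth_root (trunk_norm m N)
  | Branch i 0 => root_weight i
  | Branch i j.+1 => branch_weight i
  end.

Lemma nth_rootK x : 0 <= x -> nth_root x ^+ N = x.
Proof.
move=> x0; rewrite -powR_mulrn ?powR_ge0// -powRrM mulVf ?powRr1//.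
by rewrite pnatr_eq0 -lt0n.
Qed.

Lemma root_weight_gt0 i : (i < 2)%N -> 0 < root_weight i.
Proof.
case: i => [|[|//]] _ /=; first by rewrite divr_gt0// exprn_gt0.
by rewrite invr_gt0.
Qed.

Lemma root_weightD : root_weight 0 + root_weight 1 = 1.
Proof. by rewrite /= -[X in _ + X]mul1r -mulrDl divff// gt_eqF. Qed.

Lemma branch_weight_gt0 i : 0 < branch_weight i.
Proof. by case: i => [|i] /=; rewrite ?invr_gt0. Qed.

Lemma branch_weight_le2 i : branch_weight i <= 2.
Proof. by case: i => [|i] //=; lra. Qed.

Lemma root_norm1 : root_norm 1 = 1.
Proof. by rewrite /root_norm !expr0 !mulr1 root_weightD. Qed.

Lemma root_normE j : root_norm j.+1 = (2 ^+ N / 2 ^+ j + 2 ^+ j) / D.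
Proof. by rewrite /root_norm /= exprVn mulrDl mulrAC [X in _ + X]mulrC. Qed.

(** E[t^j] - 1 is a nonzero multiple of (2^j - 1)(2^j - 2^N), and powers of 2 are distinct. *)
Lemma root_norm_eq1 j : (root_norm j.+1 == 1) = (j == 0%N) || (j == N).
Proof.
have exp2I : injective (GRing.exp (2 : R)).
  by apply: ieexprIn => //; rewrite gt_eqF//; lra.
rewrite -(inj_eq exp2I j 0) -(inj_eq exp2I j N) expr0.
rewrite -(subr_eq0 (2 ^+ j) 1) -(subr_eq0 (2 ^+ j) (2 ^+ N)) -mulf_eq0.
rewrite root_normE -subr_eq0.
have p0 : 2 ^+ j != 0 :> R by rewrite expf_neq0.
have D_neq0 : 2 ^+ N + 1 != 0 :> R by rewrite gt_eqF.
rewrite [X in (X == 0) = _](_ : _ =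
    (2 ^+ j - 1) * (2 ^+ j - 2 ^+ N) / (2 ^+ j * (2 ^+ N + 1))).
  by rewrite [LHS]mulf_eq0 invr_eq0 [X in _ || X]mulf_eq0 (negPf p0) (negPf D_neq0) !orbF.
by rewrite /D; field; rewrite D_neq0 p0.
Qed.

Lemma trunk_norm_gt0 m k : 0 < trunk_norm m k.
Proof.
elim: m k => [|m IH] [|k] //=.
  by rewrite -[ltRHS]/(root_norm k.+1) root_normE divr_gt0//.
by rewrite mulr_gt0// powR_gt0.
Qed.

(** Keeps the trunk weights bounded: the estimate at k = N makes the next N-th root at most 2, which
    in turn propagates the estimate along the trunk. *)
Lemma trunk_norm_le m k : trunk_norm m k <= 2 ^+ k.
Proof.
elim: m k => [|m IH] [|k] /=; rewrite ?expr0//.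
- have tk i : branch_weight i ^+ k <= 2 ^+ k.
    by rewrite lerXn2r ?nnegrE ?branch_weight_le2// ltW// branch_weight_gt0.
  rewrite -[leLHS]/(root_weight 0 * branch_weight 0 ^+ k +
    root_weight 1 * branch_weight 1 ^+ k).
  apply: (@le_trans _ _ (2 ^+ k)).
    rewrite -[leRHS]mul1r -[X in _ <= X * _]root_weightD mulrDl.
    by apply: lerD; apply: ler_wpM2l; rewrite ?tk// ltW ?root_weight_gt0.
  by rewrite exprS ler_peMl ?exprn_ge0//; lra.
- have r2 : nth_root (trunk_norm m N) <= 2.
    rewrite -(@ler_pXn2r _ N)// ?nnegrE ?powR_ge0//.
    by rewrite nth_rootK ?IH// ltW// trunk_norm_gt0.
  by rewrite exprS ler_pM ?powR_ge0// ltW// trunk_norm_gt0.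
Qed.

Lemma trunk_norm_expn m : trunk_norm m N.+1 = trunk_norm m 1 ^+ N.+1.
Proof.
case: m => [|m] /=.
  rewrite -[LHS]/(root_norm N.+1) -[X in _ = X ^+ _]/(root_norm 1) root_norm1.
  by rewrite expr1n; apply/eqP; rewrite root_norm_eq1 eqxx orbT.
have -> : trunk_norm m 0 = 1 by case: m.
by rewrite mulr1 exprS nth_rootK// ltW// trunk_norm_gt0.
Qed.

Lemma weight_bounded : bounded_weight weight.
Proof.
exists 2; case=> [m|i [|j]] /=.
- rewrite powR_ge0/= -(@ler_pXn2r _ N)// ?nnegrE ?powR_ge0//.
  by rewrite nth_rootK ?trunk_norm_le// ltW// trunk_norm_gt0.
- have [i2|] := ltnP i 2; last by case: i => [|[|i]] //= _; rewrite lexx/=.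
  rewrite ltW ?root_weight_gt0//=.
  have := root_weightD; have := root_weight_gt0 (isT : (0 < 2)%N).
  have := root_weight_gt0 (isT : (1 < 2)%N).
  by case: i i2 => [|[|//]] _; lra.
- by rewrite ltW ?branch_weight_gt0// branch_weight_le2.
Qed.

Lemma weight_heavy v : v \notin heavy_children (par v) -> weight v = 0.
Proof.
by case: v => [m|[|[|i]] [|j]]; rewrite /= ?inE ?eqxx.
Qed.

Lemma weight_child u : exists2 v, par v = u & weight v != 0.
Proof.
case: u => [[|k]|i j].
- by exists (Branch 0 0) => //; rewrite gt_eqF ?root_weight_gt0.
- by exists (Trunk k) => //; rewrite gt_eqF// powR_gt0// trunk_norm_gt0.
- by exists (Branch i j.+1) => //; rewrite gt_eqF// branch_weight_gt0.
Qed.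

Lemma iter_tree_op_weight k u : iter k (tree_op weight) (fun=> 1) u =
  match u with
  | Trunk m => trunk_norm m k
  | Branch i j => branch_weight i ^+ k
  end.
Proof.
elim: k u => [|k IH] [m|i j] //=; first by case: m.
  rewrite /tree_op; case: m => [|m] /=; rewrite !big_cons big_nil addr0 !IH//.
by rewrite /tree_op /= !big_cons big_nil addr0 !IH exprS.
Qed.

Lemma tree_op_weight u : tree_op weight (fun=> 1) u =
  match u with
  | Trunk m => trunk_norm m 1
  | Branch i j => branch_weight i
  end.
Proof. by have := iter_tree_op_weight 1 u; case: u. Qed.

Lemma weight_composition_powers (mu : {measure set Vinf -> \bar R})
    (m w : Vinf -> R) :
  (forall v, mu [set v] = (m v)%:E) ->
  (forall v, m v * w v ^+ 2 = m (par v) * weight v) -> m (Trunk 0) != 0 ->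
  let A : oper (L2 mu) := weighted_composition m w in
  let Aa := adjoint L2dot A in
  [/\ bounded_everywhere L2dot A, oinjective A, ~ quasinormal L2dot A,
      opow (ocomp Aa A) N.+1 = ocomp (opow Aa N.+1) (opow A N.+1) &
      forall k, (2 <= k)%N -> k <> N.+1 ->
        opow (ocomp Aa A) k <> ocomp (opow Aa k) (opow A k)].
Proof.
move=> mum amw m0; cbv zeta.
have powE := opow_adjoint_composition mum weight_bounded weight_heavy amw.
have adjE := adjoint_opow mum weight_bounded weight_heavy amw.
split.
- exact (bounded_weighted_composition mum weight_bounded weight_heavy amw).
- exact (weighted_composition_inj mum amw weight_child).
- apply: (weighted_composition_not_quasinormal mum weight_bounded weight_heavy amw
    (u := Trunk 0) (v := Branch 1 0)) => //.
  + by rewrite gt_eqF ?root_weight_gt0.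
  + by rewrite tree_op_weight trunk_norm_gt0.
  + by rewrite !tree_op_weight [trunk_norm 0 1]root_norm1 /=; lra.
- rewrite powE adjE; congr mulop; apply/funext => u.
  rewrite tree_op_weight iter_tree_op_weight.
  by case: u => // p; rewrite trunk_norm_expn.
- move=> [|[|k]] // _ kN; rewrite powE adjE => /esym.
  have bounded1 : bounded_weight (fun _ : Vinf => 1 : R).
    by exists 1 => v; rewrite ler01 lexx.
  move/(mulop_inj mum (iter_tree_op_bounded weight_bounded k.+2 bounded1)).
  (* At the vertex 0 the power of T 1 is 1, so equality would give E[t^(k+1)] = 1, that is, k + 1 =
     N. *)
  move=> /(_ (Trunk 0) m0)/eqP; rewrite tree_op_weight iter_tree_op_weight.
  rewrite [trunk_norm 0 1]root_norm1 expr1n -/(root_norm k.+2) root_norm_eq1 /=.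
  by move/eqP => kE; apply: kN; rewrite kE.
Qed.

(** The masses solve m(v) = m(par v) a(v) with m(0) = 1, the case w = 1: division by weights up the
    trunk, multiplication along the branches. Branches with i >= 2 become null. *)
Fixpoint trunk_mass (m : nat) : R :=
  if m is p.+1 then trunk_mass p / weight (Trunk p) else 1.

Fixpoint branch_mass (i j : nat) : R :=
  (if j is l.+1 then branch_mass i l else 1) * weight (Branch i j).

Definition mass (v : Vinf) : R :=
  match v with Trunk m => trunk_mass m | Branch i j => branch_mass i j end.

Lemma weight_ge0 v : 0 <= weight v.
Proof. by have [K /(_ v)/andP[]] := weight_bounded. Qed.

Lemma mass_ge0 v : 0 <= mass v.
Proof.
case: v => [m|i j].
  elim: m => //= m IH; rewrite divr_ge0//; exact: (weight_ge0 (Trunk m)).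
elim: j => [|j IH]; first by rewrite /= mul1r; exact: (weight_ge0 (Branch i 0)).
by rewrite mulr_ge0//; exact: (weight_ge0 (Branch i j.+1)).
Qed.

Lemma mass_par v : mass v = mass (par v) * weight v.
Proof.
case: v => [m|i [|j]] //=.
by rewrite mulfVK// gt_eqF// powR_gt0// trunk_norm_gt0.
Qed.

End weights.

(** * The weighted shift and the composition operator as special cases *)

Lemma weighted_shiftE (R : realType) (w : Vinf -> R) :
  weighted_shift (fun v => (w v)%:C%C) = weighted_composition (fun=> 1) w.
Proof.
apply/seteqP; split=> p /= pw v; first by move=> _; exact: pw.
by apply: pw; rewrite oner_eq0.
Qed.

Lemma composition_operatorE (R : realType) (mu : {measure set Vinf -> \bar R})
    (m : Vinf -> R) : (forall v, mu [set v] = (m v)%:E) ->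
  composition_operator mu par = weighted_composition m (fun=> 1).
Proof.
move=> mum; apply/seteqP; split=> p /=.
  by move/(ae_eq_Vinf mum) => pw v mv; rewrite rmorph1 mul1r pw.
move=> pw; apply/(ae_eq_Vinf mum) => v mv.
by rewrite pw// rmorph1 mul1r.
Qed.

(** A vertex whose parent is massless is itself massless, so preimages of null sets consist of
    massless vertices. *)
Lemma nonsingular_par (R : realType) (mu : {measure set Vinf -> \bar R})
    (m a : Vinf -> R) : (forall v, mu [set v] = (m v)%:E) ->
  (forall v, m v = m (par v) * a v) -> nonsingular mu par.
Proof.
move=> mum ma D mD D0; apply/negligibleP => //.
have /(ae_Vinf mum) nD : {ae mu, forall v, ~ D v}.
  have /negligibleS : mu.-negligible D by apply/negligibleP.
  by apply=> v /contrapT.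
have /(ae_Vinf mum) : forall v, m v != 0 -> ~ D (par v).
  by move=> v mv; apply: nD; apply: contra_neq mv; rewrite (ma v) => ->; rewrite mul0r.
by apply: negligibleS => v /= Dv; apply.
Qed.

Theorem theorem5p3 (R : realType) (n : nat) (n_ge2 : (2 <= n)%N) :
  (exists lam : Vinf -> R[i],
     let S := weighted_shift lam in
     let Sa := adjoint L2dot S in
     [/\ bounded_everywhere L2dot S, oinjective S, ~ quasinormal L2dot S,
         opow (ocomp Sa S) n = ocomp (opow Sa n) (opow S n) &
         forall k : nat, (2 <= k)%N -> k <> n ->
           opow (ocomp Sa S) k <> ocomp (opow Sa k) (opow S k)]) /\
  (exists (d : measure_display) (X : measurableType d)
          (mu : {sigma_finite_measure set X -> \bar R}) (phi : X -> X),
     measurable_fun [set: X] phi /\ nonsingular mu phi /\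
     let C := composition_operator mu phi in
     let Ca := adjoint L2dot C in
     [/\ closed_densely_defined L2dot C, oinjective C, ~ quasinormal L2dot C,
         opow (ocomp Ca C) n = ocomp (opow Ca n) (opow C n) &
         forall k : nat, (2 <= k)%N -> k <> n ->
           opow (ocomp Ca C) k <> ocomp (opow Ca k) (opow C k)]).
Proof.
case: n n_ge2 => [//|N] N0.
split.
  exists (fun v => (Num.sqrt (weight N v))%:C%C); rewrite weighted_shiftE.
  apply: (weight_composition_powers N0 (@counting1 R)) => [v|].
    by rewrite !mul1r sqr_sqrtr// weight_ge0.
  exact: oner_neq0.
pose M v := NngNum (mass_ge0 (R := R) N0 v).
exists default_measure_display, Vinf, (point_masses M), par.
have mum : forall v, (point_masses M : {measure set Vinf -> \bar R}) [set v] =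
    (mass N v)%:E by exact: point_masses1.
split; first exact: Vinf_measurable_fun.
split; first by apply: (nonsingular_par mum) => v; exact: mass_par.
cbv zeta; rewrite (composition_operatorE mum).
have [|| Cb Ci Cq CN Ck] := weight_composition_powers N0 mum (w := fun=> 1).
- by move=> v; rewrite expr1n mulr1 -mass_par.
- exact: oner_neq0.
by split=> //; exact: bounded_closed.
Qed.
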